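(* Assume that the pair $\boldsymbol\Lambda, l$ is separating. Then the map $\tau:A_D^*\to\mathrm{Sing}\,M_{\boldsymbol\Lambda}[\Lambda^{(\infty)}]$ identifies the action of the operators $L_f^*$, $f\in A_D$, on $A_D^*$ and the action of the Bethe algebra $A_M$ on $\mathrm{Sing}\,M_{\boldsymbol\Lambda}[\Lambda^{(\infty)}]$; that is, $\tau$ is a linear isomorphism with $\tau(L_f^*(g))=\psi_{DM}(f)(\tau(g))$ for all $f\in A_D$, $g\in A_D^*$. Hence the epimorphism $\psi_{DM}:A_D\to A_M$ is an isomorphism.
   Context: Setting. $\mathfrak{gl}_2$ is the Lie algebra of complex $2\times2$ matrices with standard generators $e_{ab}$, $a,b=1,2$; $\epsilon_1,\epsilon_2$ is the standard basis of the dual of the diagonal Cartan subalgebra and $\alpha=\epsilon_1-\epsilon_2$. Fix distinct $z_1,\dots,z_n\in\mathbb C$, numbers $m_1,\dots,m_n\in\mathbb C$ and an integer $l\ge 0$. Put $\Lambda^{(s)}=m_s\epsilon_1$, $\boldsymbol\Lambda=(\Lambda^{(1)},\dots,\Lambda^{(n)})$, $\Lambda^{(\infty)}=\sum_{s=1}^n\Lambda^{(s)}-l\alpha$. The pair $\boldsymbol\Lambda,l$ is separating if $\sum_{s=1}^n m_s-2l+1+i\ne0$ for all $i=1,\dots,l$. $M_{\boldsymbol\Lambda}=M_{\Lambda^{(1)}}\otimes\cdots\otimes M_{\Lambda^{(n)}}$ is the tensor product of Verma $\mathfrak{gl}_2$-modules; $M_{\Lambda^{(s)}}$ has generating vector $v_{\Lambda^{(s)}}$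 with $e_{12}v_{\Lambda^{(s)}}=0$, $e_{11}v_{\Lambda^{(s)}}=m_sv_{\Lambda^{(s)}}$, $e_{22}v_{\Lambda^{(s)}}=0$ and basis $e_{21}^jv_{\Lambda^{(s)}}$, $j\ge0$. $M_{\boldsymbol\Lambda}[\Lambda^{(\infty)}]$ is the subspace of vectors of weight $\Lambda^{(\infty)}$ and $\mathrm{Sing}\,M_{\boldsymbol\Lambda}[\Lambda^{(\infty)}]=\{v\in M_{\boldsymbol\Lambda}: e_{12}v=0,\ e_{22}v=lv\}$. Bethe algebra $A_M$. With $\Omega_{s,r}=\sum_{i,j=1}^2e_{ij}^{(s)}e_{ji}^{(r)}$ ($e_{ij}^{(s)}$ acts in the $s$-th factor), put $\widetilde H_s=\sum_{r\ne s}\frac{1}{z_s-z_r}(m_sm_r-\Omega_{s,r})\in\mathrm{End}(M_{\boldsymbol\Lambda})$. These operators commute with each other and with $\mathfrak{gl}_2$; $H_s$ is the restriction of $\widetilde H_s$ to $\mathrm{Sing}\,M_{\boldsymbol\Lambda}[\Lambda^{(\infty)}]$. $A_M$ is the unital subalgebra of $\mathrm{End}(\mathrm{Sing}\,M_{\boldsymbol\Lambda}[\Lambda^{(\infty)}])$ generated by $H_1,\dots,H_n$. Algebra $A_D$. Let $\boldsymbol a=(a_1,\dots,a_l)$, $\boldsymbol h=(h_1,\dots,h_n)$ be variables, $p(x,\boldsymbol a)=x^l+a_1x^{l-1}+\dots+a_l$, $$\mathcal D_{\boldsymbol h}=\Big(\prod_{s=1}^n(x-z_s)\Big)\Big(\frac{d^2}{dx^2}-\sum_{s=1}^n\frac{m_s}{x-z_s}\frac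 d{dx}+\sum_{s=1}^n\frac{h_s}{x-z_s}\Big),$$ $q_{-1}(\boldsymbol h)=\sum_s h_s$, $q_0(\boldsymbol h)=\sum_s z_sh_s-l(\sum_s m_s+1-l)$. For $1\le i\le l+n-2$ let $q_i(\boldsymbol a,\boldsymbol h)$ be the coefficient of $x^{l+n-2-i}$ in $\mathcal D_{\boldsymbol h}(p(x,\boldsymbol a))$. Let $I_D\subset\mathbb C[\boldsymbol a,\boldsymbol h]$ be the ideal generated by $q_{-1},q_0,q_1,\dots,q_{l+n-2}$ and $A_D=\mathbb C[\boldsymbol a,\boldsymbol h]/I_D$. For a separating pair $A_D$ is finite-dimensional and generated by $h_1,\dots,h_n$, and $\psi_{DM}:A_D\to A_M$ is the algebra epimorphism with $h_s\mapsto H_s$, $s=1,\dots,n$. For $f\in A_D$, $L_f:A_D\to A_D$, $g\mapsto fg$, and $L_f^*:A_D^*\to A_D^*$ is the dual operator on the dual space. Map $\tau$. Identify $M_{\boldsymbol\Lambda}$ with $\mathbb C[x^{(1)},\dots,x^{(n)}]$ via $e_{21}^{j_1}v_{\Lambda^{(1)}}\otimes\cdots\otimes e_{21}^{j_n}v_{\Lambda^{(n)}}\mapsto (x^{(1)})^{j_1}\cdots(x^{(n)})^{j_n}$. The universal weight function is $$\omega=\prod_{j=1}^l\Big(\prod_{i=1}^n(t_j-z_i)\sum_{s=1}^n\frac{x^{(s)}}{t_j-z_s}\Big);$$ being a symmetric polynomial in $t_1,\dots,t_l$, it is viewed as an element of $M_{\boldsymbol\Lambda}[\Lambda^{(\infty)}]\otimes\mathbb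 C[\boldsymbol a]$ through $\prod_{i=1}^l(x-t_i)=p(x,\boldsymbol a)$. Let $\omega_D$ be its projection to $M_{\boldsymbol\Lambda}\otimes A_D$; in fact $\omega_D\in \mathrm{Sing}\,M_{\boldsymbol\Lambda}[\Lambda^{(\infty)}]\otimes A_D$. Writing $\omega_D=\sum_i v_i\otimes f_i$ with $\{f_i\}$ a basis of $A_D$, the map $\tau$ is $\tau(g)=g(\omega_D)=\sum_i g(f_i)v_i$ for $g\in A_D^*$. *)

(* Defs.v *)
From HB Require Import structures.
From mathcomp Require Import all_boot all_order all_algebra.
From mathcomp Require Import generic_quotient ring_quotient perm ring.
From mathcomp Require Import boolp reals complex.
From mathcomp Require Import mpoly.

Set Implicit Arguments.
Unset Strict Implicit.
Unset Printing Implicit Defensive.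

Import GRing.Theory.

Local Open Scope ring_scope.
Local Open Scope quotient_scope.

(* The algebras A_D and A_M may be zero (they are when n = 1 and l > 0), which
   nzRingType excludes: hence quotients, endomorphism rings and subalgebras are
   given a pzRingType structure and an lmodType structure. *)

Section Hom.
Variables (F : comNzRingType) (U V : lmodType F).

Record hom := Hom { hom_fun :> U -> V; hom_linear : `[< linear hom_fun >] }.

HB.instance Definition _ := [isSub for hom_fun].
HB.instance Definition _ := gen_eqMixin hom.
HB.instance Definition _ := gen_choiceMixin hom.

Lemma homP (f g : hom) : f =1 g -> f = g.
Proof. by move=> fg; apply/val_inj/funext. Qed.

HB.instance Definition _ (f : hom) :=
  GRing.isLinear.Build F U V *:%R (hom_fun f) (elimT (asboolP _) (hom_linear f)).

Definition mk_hom (f : {linear U -> V}) : hom :=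
  Hom (introT (asboolP _) (@linearP F U V *:%R f)).

Fact hom_zero_subproof : linear (fun _ : U => 0 : V).
Proof. by move=> a u v; rewrite scaler0 addr0. Qed.
Fact hom_opp_subproof (f : hom) : linear (fun u => - f u).
Proof. by move=> a u v; rewrite linearP opprD scalerN. Qed.
Fact hom_add_subproof (f g : hom) : linear (fun u => f u + g u).
Proof. by move=> a u v; rewrite !linearP scalerDr addrACA. Qed.
Fact hom_scale_subproof c (f : hom) : linear (fun u => c *: f u).
Proof. by move=> a u v; rewrite linearP scalerDr !scalerA mulrC. Qed.

Definition hom_zero := Hom (introT (asboolP _) hom_zero_subproof).
Definition hom_opp f := Hom (introT (asboolP _) (hom_opp_subproof f)).
Definition hom_add f g := Hom (introT (asboolP _) (hom_add_subproof f g)).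
Definition hom_scale c f := Hom (introT (asboolP _) (hom_scale_subproof c f)).

Fact hom_addA : associative hom_add.
Proof. by move=> f g h; apply: homP => u; apply: addrA. Qed.
Fact hom_addC : commutative hom_add.
Proof. by move=> f g; apply: homP => u; apply: addrC. Qed.
Fact hom_add0 : left_id hom_zero hom_add.
Proof. by move=> f; apply: homP => u; apply: add0r. Qed.
Fact hom_addN : left_inverse hom_zero hom_opp hom_add.
Proof. by move=> f; apply: homP => u; apply: addNr. Qed.

HB.instance Definition _ :=
  GRing.isZmodule.Build hom hom_addA hom_addC hom_add0 hom_addN.

Fact hom_scaleA a b f : hom_scale a (hom_scale b f) = hom_scale (a * b) f.
Proof. by apply: homP => u; apply: scalerA. Qed.
Fact hom_scale1 : left_id 1 hom_scale.
Proof. by move=> f; apply: homP => u; apply: scale1r. Qed.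
Fact hom_scaleDr : right_distributive hom_scale +%R.
Proof. by move=> a f g; apply: homP => u; apply: scalerDr. Qed.
Fact hom_scaleDl f : {morph hom_scale^~ f : a b / a + b}.
Proof. by move=> a b; apply: homP => u; apply: scalerDl. Qed.

HB.instance Definition _ := GRing.Zmodule_isLmodule.Build F hom
  hom_scaleA hom_scale1 hom_scaleDr hom_scaleDl.

End Hom.

Definition dual (F : comNzRingType) (V : lmodType F) := hom V F^o.
HB.instance Definition _ (F : comNzRingType) (V : lmodType F) :=
  GRing.Lmodule.on (dual V).

Section Endo.
Variables (F : comNzRingType) (V : lmodType F).

Definition endo := hom V V.
HB.instance Definition _ := GRing.Lmodule.on endo.

Definition endo_one : endo := mk_hom (@idfun V : {linear V -> V}).
Definition endo_mul (f g : endo) : endo :=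
  mk_hom ((f : hom V V) \o (g : hom V V) : {linear V -> V}).

Fact endo_mulA : associative endo_mul.
Proof. by move=> f g h; apply: homP. Qed.
Fact endo_mul1l : left_id endo_one endo_mul.
Proof. by move=> f; apply: homP. Qed.
Fact endo_mul1r : right_id endo_one endo_mul.
Proof. by move=> f; apply: homP. Qed.
Fact endo_mulDl : left_distributive endo_mul +%R.
Proof. by move=> f g h; apply: homP. Qed.
Fact endo_mulDr : right_distributive endo_mul +%R.
Proof. by move=> f g h; apply: homP => u; apply: (raddfD (f : hom V V)). Qed.

HB.instance Definition _ := GRing.Zmodule_isPzRing.Build endo
  endo_mulA endo_mul1l endo_mul1r endo_mulDl endo_mulDr.

Definition transpose (T : endo) (g : dual V) : dual V :=
  mk_hom ((g : hom V F^o) \o (T : hom V V) : {linear V -> F^o}).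

End Endo.

Section GeneratedSubalgebra.
Variables (F : comNzRingType) (V : lmodType F) (J : Type) (X : J -> endo V).

Definition unital_subalg (S : endo V -> Prop) : Prop :=
  [/\ S 1, forall (c : F) f g, S f -> S g -> S (c *: f + g)
    & forall f g, S f -> S g -> S (f * g)].

Definition gen_subalg_pred : {pred endo V} := fun T =>
  `[< forall S, unital_subalg S -> (forall j, S (X j)) -> S T >].

Fact gen_subalg_subring : subring_closed gen_subalg_pred.
Proof.
split=> [|f g /asboolP fX /asboolP gX|f g /asboolP fX /asboolP gX].
- by apply/asboolP=> S [].
- apply/asboolP=> S SA SX; have [_ SD _] := SA.
  by rewrite addrC -scaleN1r; apply: SD; [apply: gX | apply: fX].
- by apply/asboolP=> S SA SX; have [_ _ SM] := SA; apply: SM; [apply: fX | apply: gX].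
Qed.

HB.instance Definition _ :=
  GRing.isSubringClosed.Build (endo V) gen_subalg_pred gen_subalg_subring.

Fact gen_subalg_scale : GRing.scaler_closed gen_subalg_pred.
Proof.
move=> c f /asboolP fX; apply/asboolP=> S SA SX; have [S1 SD _] := SA.
rewrite -[_ *: _]addr0; apply: (SD); first exact: fX.
by rewrite -(addNr 1) -scaleN1r; apply: SD.
Qed.

HB.instance Definition _ :=
  GRing.isScaleClosed.Build F (endo V) gen_subalg_pred gen_subalg_scale.

Record gen_subalg :=
  GenSubalg { gen_subalg_val :> endo V; _ : gen_subalg_val \in gen_subalg_pred }.

HB.instance Definition _ := [isSub for gen_subalg_val].
HB.instance Definition _ := [Choice of gen_subalg by <:].
HB.instance Definition _ := GRing.SubChoice_isSubPzRing.Build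
  (endo V) gen_subalg_pred gen_subalg gen_subalg_subring.
HB.instance Definition _ := [SubZmodule_isSubLmodule of gen_subalg by <:].

Fact gen_subalg_mem j : X j \in gen_subalg_pred.
Proof. by apply/asboolP=> S _; apply. Qed.

Definition gen_subalg_gen j : gen_subalg := GenSubalg (gen_subalg_mem j).

End GeneratedSubalgebra.

Section QuotientAlgebra.
Variables (F : comNzRingType) (A : comAlgType F) (J : finType) (q : J -> A).

Definition gen_ideal : {pred A} := fun f =>
  `[< exists c : J -> A, f = \sum_j c j * q j >].

Lemma gen_idealM a f : f \in gen_ideal -> a * f \in gen_ideal.
Proof.
move=> /asboolP[c ->]; apply/asboolP; exists (fun j => a * c j).
by rewrite mulr_sumr; apply: eq_bigr => j _; rewrite mulrA.
Qed.

Fact gen_ideal_zmod : zmod_closed gen_ideal.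
Proof.
split=> [|f g /asboolP[c ->] /asboolP[d ->]]; apply/asboolP.
  by exists (fun _ => 0); rewrite big1 // => j _; rewrite mul0r.
exists (fun j => c j - d j); rewrite -sumrB.
by apply: eq_bigr => j _; rewrite mulrBl.
Qed.

HB.instance Definition _ :=
  GRing.isZmodClosed.Build A gen_ideal gen_ideal_zmod.

Definition quot_alg := Quotient.quot gen_ideal.
HB.instance Definition _ := GRing.Zmodule.on quot_alg.

Definition quot_pi (f : A) : quot_alg := \pi_(Quotient.quot gen_ideal) f.

Lemma quot_piE f g : (quot_pi f = quot_pi g) <-> (f - g \in gen_ideal).
Proof.
by split=> [/eqP fg|fg]; [|apply/eqP];
  move: fg; rewrite /quot_pi -(@Quotient.idealrBE _ gen_ideal).
Qed.

Lemma quot_reprK (x : quot_alg) : quot_pi (repr x) = x.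
Proof. exact: reprK. Qed.

Lemma quot_piD : {morph quot_pi : f g / f + g}.
Proof. exact: (@Quotient.pi_add _ gen_ideal). Qed.

Definition quot_mul (x y : quot_alg) : quot_alg := quot_pi (repr x * repr y).
Definition quot_scale (c : F) (x : quot_alg) : quot_alg := quot_pi (c *: repr x).

Lemma quot_repr_pi f : repr (quot_pi f) - f \in gen_ideal.
Proof. by apply/quot_piE; rewrite quot_reprK. Qed.

Lemma quot_piM f g : quot_pi (f * g) = quot_mul (quot_pi f) (quot_pi g).
Proof.
apply/esym/quot_piE; set f' := repr _; set g' := repr _.
have -> : f' * g' - f * g = g' * (f' - f) + f * (g' - g).
  by ring.
by rewrite rpredD // gen_idealM // quot_repr_pi.
Qed.

Lemma quot_piZ c f : quot_pi (c *: f) = quot_scale c (quot_pi f).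
Proof.
apply/esym/quot_piE; rewrite -scalerBr -mulr_algl.
by rewrite gen_idealM // quot_repr_pi.
Qed.

Fact quot_mulA : associative quot_mul.
Proof.
move=> x y t; rewrite -(quot_reprK x) -(quot_reprK y) -(quot_reprK t).
by rewrite -!quot_piM mulrA.
Qed.
Fact quot_mulC : commutative quot_mul.
Proof.
by move=> x y; rewrite -(quot_reprK x) -(quot_reprK y) -!quot_piM mulrC.
Qed.
Fact quot_mul1 : left_id (quot_pi 1) quot_mul.
Proof. by move=> x; rewrite -(quot_reprK x) -!quot_piM mul1r. Qed.
Fact quot_mulDl : left_distributive quot_mul +%R.
Proof.
move=> x y t; rewrite -(quot_reprK x) -(quot_reprK y) -(quot_reprK t).
by rewrite -quot_piD -!quot_piM mulrDl quot_piD.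
Qed.

HB.instance Definition _ := GRing.Zmodule_isComPzRing.Build quot_alg
  quot_mulA quot_mulC quot_mul1 quot_mulDl.

Fact quot_scaleA a b x : quot_scale a (quot_scale b x) = quot_scale (a * b) x.
Proof. by rewrite -(quot_reprK x) -!quot_piZ scalerA. Qed.
Fact quot_scale1 : left_id 1 quot_scale.
Proof. by move=> x; rewrite -(quot_reprK x) -!quot_piZ scale1r. Qed.
Fact quot_scaleDr : right_distributive quot_scale +%R.
Proof.
move=> a x y; rewrite -(quot_reprK x) -(quot_reprK y).
by rewrite -quot_piD -!quot_piZ scalerDr quot_piD.
Qed.
Fact quot_scaleDl x : {morph quot_scale^~ x : a b / a + b}.
Proof.
by move=> a b; rewrite -(quot_reprK x) -!quot_piZ scalerDl quot_piD.
Qed.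

HB.instance Definition _ := GRing.Zmodule_isLmodule.Build F quot_alg
  quot_scaleA quot_scale1 quot_scaleDr quot_scaleDl.

Fact quot_pi_is_zmod_morphism : zmod_morphism quot_pi.
Proof.
move=> f g; rewrite quot_piD; congr (_ + _).
exact: (@Quotient.pi_opp _ gen_ideal).
Qed.
Fact quot_pi_is_monoid_morphism : monoid_morphism quot_pi.
Proof. by split=> // f g; apply: quot_piM. Qed.
Fact quot_pi_is_scalable : scalable quot_pi.
Proof. by move=> c f; apply: quot_piZ. Qed.

HB.instance Definition _ :=
  GRing.isZmodMorphism.Build A quot_alg quot_pi quot_pi_is_zmod_morphism.
HB.instance Definition _ :=
  GRing.isMonoidMorphism.Build A quot_alg quot_pi quot_pi_is_monoid_morphism.
HB.instance Definition _ :=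
  GRing.isScalable.Build F A quot_alg *:%R quot_pi quot_pi_is_scalable.

Fact quot_lmul_subproof (f : quot_alg) : linear (fun g : quot_alg => f * g).
Proof.
move=> c x y; rewrite mulrDr; congr (_ + _).
rewrite -(quot_reprK f) -(quot_reprK x) -linearZ -!rmorphM -linearZ /=.
by rewrite scalerAr.
Qed.

Definition lmul (f : quot_alg) : endo quot_alg :=
  Hom (introT (asboolP _) (quot_lmul_subproof f)).

End QuotientAlgebra.

Section Verma.
Variables (F : fieldType) (n : nat) (m : 'I_n -> F).
Implicit Types (s r t : 'I_n) (a b c d : 'I_2) (v : {mpoly F[n]}).

(* M_Lambda is {mpoly F[n]}: the monomial 'X_[k] stands for the tensor product
   of the vectors e_21^(k s) v_(Lambda^(s)), and matrix indices 1, 2 are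
   0, 1 : 'I_2.  Since e_12 e_21^j v = j (m_s - j + 1) e_21^(j-1) v in the Verma
   module of highest weight m_s epsilon_1, the generators act in the s-th factor
   by the differential operators below; gl2_act_bracket,
   gl2_act_vac, gl2_act21 and gl2_act12X check this. *)
Definition gl2_act s a b v : {mpoly F[n]} :=
  if a == 0 then
    if b == 0 then m s *: v - 'X_s * v^`M(s)
    else m s *: v^`M(s) - 'X_s * v^`M(s)^`M(s)
  else if b == 0 then 'X_s * v else 'X_s * v^`M(s).

Fact gl2_act_linear s a b : linear (gl2_act s a b).
Proof.
move=> c u v; rewrite /gl2_act.
case: (a == 0); case: (b == 0); rewrite ?(mderivD, mderivZ) -!mul_mpolyC; ring.
Qed.

HB.instance Definition _ s a b :=
  GRing.isLinear.Build F {mpoly F[n]} {mpoly F[n]} *:%R (gl2_act s a b)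
    (gl2_act_linear s a b).

Lemma mderivU s r : ('X_r : {mpoly F[n]})^`M(s) = (r == s)%:R.
Proof.
rewrite mderivX mnm1E; case: eqVneq => [->|_]; last by rewrite scale0r.
rewrite scale1r (_ : (_ - _)%MM = 0%MM) ?mpolyX0 //.
by apply/mnmP => i; rewrite mnmBE subnn mnm0E.
Qed.

Lemma mderiv1 s : (1 : {mpoly F[n]})^`M(s) = 0.
Proof. by rewrite -mpolyC1 mderivC. Qed.

Lemma I2P (P : 'I_2 -> Prop) : P 0 -> P 1 -> forall a, P a.
Proof.
move=> P0 P1 [[|[|//]] ia]; first by rewrite (_ : Ordinal ia = 0) //; apply/val_inj.
by rewrite (_ : Ordinal ia = 1) //; apply/val_inj.
Qed.

Lemma gl2_act_bracket s r a b c d v :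
  gl2_act s a b (gl2_act r c d v) - gl2_act r c d (gl2_act s a b v) =
  if s == r then (b == c)%:R *: gl2_act s a d v - (a == d)%:R *: gl2_act s c b v
  else 0.
Proof.
case: eqVneq => [<-|sr].
  move: a b c d; do 4!elim/I2P; rewrite /gl2_act /= ?scale0r ?scale1r;
  rewrite ?(mderivB, mderivD, mderivZ, mderivM, mderivU, mderiv1, eqxx) /= ?mderiv1 -?mul_mpolyC;
  ring.
have rs : (r == s) = false by rewrite eq_sym (negPf sr).
move: a b c d; do 4!elim/I2P; rewrite /gl2_act /=;
rewrite ?(mderivB, mderivD, mderivZ, mderivM, mderivU, eqxx, rs, negPf sr) /=;
rewrite ?mderiv0 -?mul_mpolyC ?(mderiv_comm r s);
ring.
Qed.

Lemma gl2_act_vac s :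
  [/\ gl2_act s 0 1 1 = 0, gl2_act s 0 0 1 = m s *: 1 & gl2_act s 1 1 1 = 0].
Proof.
by rewrite /gl2_act /= -mpolyC1 !(mderivC, mderiv0) !(mulr0, scaler0, subr0).
Qed.

Lemma gl2_act21 s v : gl2_act s 1 0 v = 'X_s * v.
Proof. by []. Qed.

Lemma gl2_act12X s (k : 'X_{1..n}) :
  gl2_act s 0 1 'X_[k] =
  ((k s)%:R * (m s - (k s)%:R + 1)) *: 'X_[k - U_(s)].
Proof.
rewrite /gl2_act /= mderivX mderivZ mderivX mnmBE mnm1E eqxx.
case ks: (k s) => [|[|j]].
- by rewrite mul0r !scale0r scaler0 mulr0 subr0.
- by rewrite subnn scale0r scaler0 mulr0 subr0 scale1r subrK mul1r.
have -> : 'X_[k - U_(s)] = 'X_s * 'X_[k - U_(s) - U_(s)] :> {mpoly F[n]}.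
  rewrite -mpolyXD addmC submK //; apply/mnm_lepP => i.
  by rewrite mnmBE !mnm1E; case: eqVneq => // <-; rewrite ks.
rewrite subn1 -pred_Sn -(natr1 j.+1) -(natr1 j).
move: j%:R => c; rewrite -!mul_mpolyC !(rmorphD, rmorphM, rmorphN, rmorph1) /=.
ring.
Qed.

Definition gl2_tot a b v : {mpoly F[n]} := \sum_s gl2_act s a b v.

Fact gl2_tot_linear a b : linear (gl2_tot a b).
Proof.
move=> c u v; rewrite /gl2_tot scaler_sumr -big_split /=.
by apply: eq_bigr => s _; rewrite linearP.
Qed.

HB.instance Definition _ a b :=
  GRing.isLinear.Build F {mpoly F[n]} {mpoly F[n]} *:%R (gl2_tot a b)
    (gl2_tot_linear a b).

Definition Omega s r v : {mpoly F[n]} :=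
  \sum_i \sum_j gl2_act s i j (gl2_act r j i v).

Fact Omega_linear s r : linear (Omega s r).
Proof.
move=> c u v; rewrite /Omega scaler_sumr -big_split /=.
apply: eq_bigr => i _; rewrite scaler_sumr -big_split /=.
by apply: eq_bigr => j _; rewrite !linearP.
Qed.

HB.instance Definition _ s r :=
  GRing.isLinear.Build F {mpoly F[n]} {mpoly F[n]} *:%R (Omega s r)
    (Omega_linear s r).

Lemma gl2_act_comm s r a b c d v : s != r ->
  gl2_act s a b (gl2_act r c d v) = gl2_act r c d (gl2_act s a b v).
Proof.
by move=> sr; apply/eqP; rewrite -subr_eq0 gl2_act_bracket (negPf sr).
Qed.

Lemma gl2_act_bracket1 s a b c d v :
  gl2_act s a b (gl2_act s c d v) = gl2_act s c d (gl2_act s a b v)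
    + ((b == c)%:R *: gl2_act s a d v - (a == d)%:R *: gl2_act s c b v).
Proof.
have := gl2_act_bracket s s a b c d v; rewrite eqxx => <-.
by rewrite addrC subrK.
Qed.

Lemma sum_delta (f : 'I_2 -> {mpoly F[n]}) a :
  \sum_i (a == i)%:R *: f i = f a.
Proof.
rewrite (bigD1 a) //= eqxx scale1r big1 ?addr0 // => i.
by rewrite eq_sym => /negPf->; rewrite scale0r.
Qed.

Lemma Omega_gl2_l s r a b v : s != r ->
  gl2_act s a b (Omega s r v) = Omega s r (gl2_act s a b v) +
    (\sum_i gl2_act s a i (gl2_act r i b v)
     - \sum_i gl2_act s i b (gl2_act r a i v)).
Proof.
move=> sr; rewrite /Omega linear_sum /=.
under eq_bigr => i _.
  rewrite linear_sum /=.
  under eq_bigr => j _ do rewrite gl2_act_bracket1 (gl2_act_comm _ _ _ _ _ sr).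
  rewrite big_split /= sumrB -scaler_sumr.
  rewrite (sum_delta (fun j => gl2_act s i b (gl2_act r j i v)) a).
  over.
rewrite big_split /= sumrB.
by rewrite (sum_delta (fun i => \sum_j gl2_act s a j (gl2_act r j i v)) b).
Qed.

Lemma Omega_gl2_r s r a b v : s != r ->
  gl2_act r a b (Omega s r v) = Omega s r (gl2_act r a b v) +
    (\sum_i gl2_act s i b (gl2_act r a i v)
     - \sum_i gl2_act s a i (gl2_act r i b v)).
Proof.
move=> sr; have rs : r != s by rewrite eq_sym.
rewrite /Omega linear_sum /=.
under eq_bigr => i _.
  rewrite linear_sum /=.
  under eq_bigr => j _.
    rewrite (gl2_act_comm _ _ _ _ _ rs) gl2_act_bracket1.
    rewrite linearD linearB !linearZ /= ?scalerN; over.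
  rewrite big_split /= sumrB -scaler_sumr.
  rewrite (sum_delta (fun j => gl2_act s i j (gl2_act r a i v)) b).
  over.
rewrite big_split /= sumrB.
by rewrite (sum_delta (fun i => \sum_j gl2_act s i j (gl2_act r j b v)) a).
Qed.

Lemma Omega_gl2_tot s r a b v : s != r ->
  gl2_tot a b (Omega s r v) = Omega s r (gl2_tot a b v).
Proof.
move=> sr; have rs : r != s by rewrite eq_sym.
rewrite /gl2_tot [RHS]linear_sum /=.
rewrite [LHS](bigD1 s) // [RHS](bigD1 s) //=.
rewrite [X in _ + X = _](bigD1 r) // [X in _ = _ + X](bigD1 r) //=.
rewrite !addrA; congr (_ + _).
  rewrite Omega_gl2_l // Omega_gl2_r // addrACA -[RHS]addr0; congr (_ + _).
  by rewrite -opprB addNr.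
apply: eq_bigr => t /andP[ts tr]; rewrite /Omega linear_sum /=.
apply: eq_bigr => i _; rewrite linear_sum; apply: eq_bigr => j _ /=.
by rewrite !(gl2_act_comm _ _ _ _ _ ts, gl2_act_comm _ _ _ _ _ tr).
Qed.

End Verma.

Lemma mcoeff_map_mpoly0 (R S : comNzRingType) k (f : R -> S) (p : {mpoly R[k]}) i :
  f 0 = 0 -> (map_mpoly f p)@_i = f p@_i.
Proof.
move=> f0; rewrite /map_mpoly /mmap raddf_sum /=.
under eq_bigr => j _ do rewrite mmap1_id mul_mpolyC mcoeffZ mcoeffX.
have [ip|/memN_msupp_eq0 pi0] := boolP (i \in msupp p).
  rewrite (bigD1_seq i) ?msupp_uniq //= eqxx mulr1 big1 ?addr0 // => j.
  by move=> /negPf->; rewrite mulr0.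
rewrite pi0 f0 big1_seq // => j /= jp; case: eqVneq => [ji|]; last by rewrite mulr0.
by rewrite ji pi0 f0 mul0r.
Qed.

Section Gaudin.
Variables (F : fieldType) (n l : nat) (z m : 'I_n -> F).

Definition sing_pred : {pred {mpoly F[n]}} := fun v =>
  (gl2_tot m 0 1 v == 0) && (gl2_tot m 1 1 v == l%:R *: v).

Fact sing_submod : submod_closed sing_pred.
Proof.
split=> [|c u v]; rewrite !unfold_in; first by rewrite !linear0 eqxx.
move=> /andP[/eqP u1 /eqP u2] /andP[/eqP v1 /eqP v2].
by rewrite !linearP /= u1 v1 u2 v2 scaler0 addr0 !eqxx.
Qed.

HB.instance Definition _ :=
  GRing.isSubmodClosed.Build F {mpoly F[n]} sing_pred sing_submod.

Record sing := Sing { sing_val :> {mpoly F[n]}; _ : sing_val \in sing_pred }.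

HB.instance Definition _ := [isSub for sing_val].
HB.instance Definition _ := [Choice of sing by <:].
HB.instance Definition _ := [SubChoice_isSubLmodule of sing by <:].

Definition Htilde (s : 'I_n) (v : {mpoly F[n]}) : {mpoly F[n]} :=
  \sum_(r | r != s) (z s - z r)^-1 *: ((m s * m r) *: v - Omega m s r v).

Fact Htilde_linear s : linear (Htilde s).
Proof.
move=> c u v; rewrite /Htilde scaler_sumr -big_split /=.
apply: eq_bigr => r _.
rewrite Omega_linear; set b := m s * m r; set Ou := Omega m s r u.
set Ov := Omega m s r v; set d := _^-1.
have -> : b *: (c *: u + v) - (c *: Ou + Ov) =
    c *: (b *: u - Ou) + (b *: v - Ov).
  by rewrite scalerDr scalerBr opprD addrACA !scalerA (mulrC b).
by rewrite scalerDr !scalerA (mulrC d).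
Qed.

Lemma Htilde_gl2_tot s a b v :
  gl2_tot m a b (Htilde s v) = Htilde s (gl2_tot m a b v).
Proof.
rewrite /Htilde linear_sum; apply: eq_bigr => r rs /=.
by rewrite linearZ /= linearB linearZ /= Omega_gl2_tot // eq_sym.
Qed.

Fact Htilde_sing s (v : sing) : Htilde s v \in sing_pred.
Proof.
have h0 : Htilde s 0 = 0.
  by have := Htilde_linear s (-1) 0 0; rewrite scaler0 add0r scaleN1r addNr.
have hZ c u : Htilde s (c *: u) = c *: Htilde s u.
  by have := Htilde_linear s c u 0; rewrite h0 !addr0.
case: v => v /= /andP[/eqP v1 /eqP v2].
by rewrite unfold_in !Htilde_gl2_tot v1 v2 h0 hZ !eqxx.
Qed.

Fact Ham_linear s : linear (fun v : sing => Sing (Htilde_sing s v)).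
Proof. by move=> c u v; apply/val_inj; rewrite /= Htilde_linear. Qed.

Definition Ham s : endo sing := Hom (introT (asboolP _) (Ham_linear s)).

Definition A_M := gen_subalg Ham.
HB.instance Definition _ := GRing.PzRing.on A_M.
HB.instance Definition _ := GRing.Lmodule.on A_M.

Definition Ham_M s : A_M := gen_subalg_gen Ham s.

(* C[a, h] is {mpoly F[l + n]}; avar i is the variable a_(i+1). *)
Definition avar (i : 'I_l) : {mpoly F[l + n]} := 'X_(lshift n i).
Definition hvar (s : 'I_n) : {mpoly F[l + n]} := 'X_(rshift l s).

Definition p_a : {poly {mpoly F[l + n]}} :=
  'X^l + \sum_(i < l) avar i *: 'X^(l - i.+1).

(* D_h, with the denominators x - z_s cleared. *)
Definition D_h (p : {poly {mpoly F[l + n]}}) : {poly {mpoly F[l + n]}} :=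
  let x_ r := 'X - ((z r)%:MP)%:P in
  (\prod_r x_ r) * p^`(2)
  - (\sum_s (m s)%:MP *: \prod_(r | r != s) x_ r) * p^`()
  + (\sum_s hvar s *: \prod_(r | r != s) x_ r) * p.

(* q_D j is q_(j-1), for 0 <= j <= l + n - 1. *)
Definition q_D (j : 'I_(l + n - 2).+2) : {mpoly F[l + n]} :=
  match val j with
  | 0%N => \sum_s hvar s
  | 1%N => \sum_s z s *: hvar s - (l%:R * (\sum_s m s + 1 - l%:R))%:MP
  | i.+1 => (D_h p_a)`_(l + n - 2 - i)
  end.

Definition A_D := quot_alg q_D.
HB.instance Definition _ := GRing.ComPzRing.on A_D.
HB.instance Definition _ := GRing.Lmodule.on A_D.

Definition pi_D : {mpoly F[l + n]} -> A_D := quot_pi q_D.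
Definition h_D (s : 'I_n) : A_D := pi_D (hvar s).

Definition L_D : A_D -> endo A_D := @lmul F {mpoly F[l + n]} _ q_D.

(* The universal weight function as a polynomial in the x^(s) with
   coefficients in C[t_1, ..., t_l]. *)
Definition omega_t : {mpoly {mpoly F[l]}[n]} :=
  \prod_(j < l) \sum_s (\prod_(i | i != s) ('X_j - (z i)%:MP)) *: 'X_s.

(* Rewrites a symmetric polynomial in t as a polynomial in a: as
   prod_i (x - t_i) = p(x, a), the i-th elementary symmetric polynomial of t
   is (-1)^i a_i. *)
Definition sym_to_a (c : {mpoly F[l]}) : {mpoly F[l + n]} :=
  symf c \mPo [tuple (-1) ^+ i.+1 *: avar i | i < l].

Definition omega_a : {mpoly {mpoly F[l + n]}[n]} := map_mpoly sym_to_a omega_t.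

(* Values of the variables a, h at which p(x, a) = prod_i (x - t_i). *)
Definition a_of_t : (l + n).-tuple {mpoly F[l]} :=
  [tuple if split i is inl j then (-1) ^+ j.+1 *: mesym l F j.+1 else 0
    | i < l + n].

Lemma avar_a_of_t i : avar i \mPo a_of_t = (-1) ^+ i.+1 *: mesym l F i.+1.
Proof. by rewrite comp_mpolyXU -tnth_nth tnth_mktuple (unsplitK (inl i)). Qed.

Lemma p_a_of_t : map_poly (comp_mpoly a_of_t) p_a =
  \prod_(i < l) ('X - ('X_i)%:P).
Proof.
have tE : \prod_(i < l) ('X - ('X_i)%:P) =
    \prod_(c <- [tuple ('X_i : {mpoly F[l]}) | i < l]) ('X - c%:P).
  by rewrite big_tuple; apply: eq_bigr => i _; rewrite tnth_mktuple.
have eE k : (mesym l {mpoly F[l]} k).@[tnth [tuple 'X_i | i < l]] = mesym l F k.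
  rewrite /mesym rmorph_sum; apply: eq_bigr => h _ /=.
  rewrite rmorph_prod; apply: eq_bigr => i _ /=.
  by rewrite mevalXU tnth_mktuple.
rewrite tE; set P := \prod_(c <- _) _.
have szP : size P = l.+1 by rewrite size_prod_XsubC size_tuple.
rewrite -[P]coefK szP poly_def (reindex_inj rev_ord_inj) /=.
have PE (k : 'I_l.+1) : P`_(l.+1 - k.+1) = (-1) ^+ k * mesym l F k.
  by rewrite subSS mroots_coeff eE.
under [RHS]eq_bigr => k _ do rewrite PE subSS.
rewrite big_ord_recl /= expr0 mul1r mesym0E scale1r subn0.
rewrite rmorphD rmorph_sum /= map_polyXn; congr (_ + _).
apply: eq_bigr => i _; rewrite map_polyZ map_polyXn /=.
by rewrite avar_a_of_t -mul_mpolyC rmorphXn rmorphN1.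
Qed.

Lemma sym_to_a_of_t c : c \is symmetric -> sym_to_a c \mPo a_of_t = c.
Proof.
move=> c_sym; rewrite {2}(symfP c_sym) /sym_to_a !(comp_mpolyEX (symf c)).
rewrite rmorph_sum /=; apply: eq_bigr => k _.
rewrite linearZ /= !comp_mpolyX rmorph_prod /=; congr (_ *: _).
apply: eq_bigr => i _; rewrite rmorphXn /= !tnth_mktuple linearZ /=.
by rewrite avar_a_of_t scalerA -exprMn mulrNN mulr1 expr1n scale1r.
Qed.

Lemma omega_t_sym k : omega_t@_k \is symmetric.
Proof.
apply/issymP => sg; rewrite -mcoeff_map_mpoly; congr (mcoeff k _).
rewrite /omega_t rmorph_prod /= [RHS](reindex_inj (@perm_inj _ sg)) /=.
apply: eq_bigr => j _; rewrite rmorph_sum /=; apply: eq_bigr => s _.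
rewrite map_mpolyZ map_mpolyX rmorph_prod /=; congr (_ *: _).
apply: eq_bigr => i _; rewrite rmorphB /= msymX -(mulr1 (z i)%:MP) mul_mpolyC msymZ msym1.
congr ('X_[_] - _); apply/mnmP => r; rewrite mnmE !mnm1E.
by rewrite -(inj_eq (@perm_inj _ sg)) permKV.
Qed.

Lemma omega_a_of_t :
  map_mpoly (comp_mpoly a_of_t) omega_a = omega_t.
Proof.
apply/mpolyP => k; rewrite mcoeff_map_mpoly /= mcoeff_map_mpoly0.
  exact/sym_to_a_of_t/omega_t_sym.
by rewrite /sym_to_a /symf symfnE0 comp_mpoly0.
Qed.

(* tau_fun g = (id (x) g)(omega_D), where omega_D, the image of omega_a in
   M_Lambda (x) A_D, is expanded along the monomial basis of M_Lambda. *)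
Definition tau_fun (g : dual A_D) : {mpoly F[n]} :=
  \sum_(k <- msupp omega_a) (g (pi_D omega_a@_k)) *: 'X_[k].

Definition separating : Prop :=
  forall i : nat, (1 <= i <= l)%N ->
    \sum_s m s - (2 * l)%:R + 1 + i%:R != 0.

(* A_D and A_M have no lalgType structure, so an algebra morphism is a ring
   morphism which is scalable. *)
Definition is_psi_DM (psi : {rmorphism A_D -> A_M}) : Prop :=
  [/\ scalable psi, forall s, psi (h_D s) = Ham_M s
    & forall T : A_M, exists f, psi f = T].

End Gaudin.

(* Main.v *)
(* Write P_x(t) = sum_s x_s prod_(r != s) (t - z_r) = (sum_s x_s) prod_k (t - u_k);
   the roots u_1, ..., u_(n-1) are Sklyanin's separated coordinates of x.  In
   these coordinates the Gaudin operators satisfy, for each k,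
     (A(u_k) d^2/du_k^2 - B(u_k) d/du_k + sum_s A_s(u_k) Htilde_s) v = 0,
   with A = prod_s (x - z_s), A_s = A / (x - z_s) and B = sum_s m_s A_s, whereas
   omega becomes, up to sign, prod_k p(u_k).  In A_D the polynomial p satisfies
   the same differential equation with h_s in place of Htilde_s.  Since the
   n - 1 equations together with sum_s Htilde_s = 0 determine all Htilde_s, this
   gives Htilde_s omega_D = h_s omega_D and the commutativity of the Htilde_s.
   As A_D is generated by the h_s (this is where separation is used), tau is
   injective.

   Conversely, solving D_h p = 0 for the coefficients of p from the top down
   defines operators b_i on Sing as polynomials in the H_s.  Separation of
   variables shows that the coefficient of prod_k u_k^(q_k) in a singular vector
   v is the top coefficient of (prod_k b_(q_k)) v, and from this that the b_i and
   H_s satisfy all the relations of A_D.  So A_D acts on Sing, and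
   f |-> (top coefficient of f v) is, up to sign, a preimage of v under tau. *)
Require Import Defs.
From HB Require Import structures.
From mathcomp Require Import all_boot all_order all_algebra.
From mathcomp Require Import ring zify reals complex boolp.
From mathcomp Require Import mpoly ssrcomplements.
From mathcomp Require classical_sets.

Set Implicit Arguments.
Unset Strict Implicit.
Unset Printing Implicit Defensive.

Import GRing.Theory Num.Theory.

Local Open Scope ring_scope.

(** * Separated coordinates *)

Section MpolyCalculus.
Variables (F : fieldType) (n : nat).
Implicit Types (p q : {mpoly F[n]}).

Lemma mpoly_ind_mul (P : {mpoly F[n]} -> Prop) :
  (forall c, P c%:MP) -> (forall i, P 'X_i) ->
  (forall p q, P p -> P q -> P (p + q)) ->
  (forall p q, P p -> P q -> P (p * q)) -> forall p, P p.
Proof.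
move=> PC PX PD PM; elim/mpolyind=> [|c k p _ _ Pp].
  by rewrite -(mpolyC0 n F); apply: PC.
apply: (PD) => //; rewrite -mul_mpolyC; apply: (PM); first exact: PC.
rewrite mpolyXE_id; apply: (big_ind P) => [||i _]; [exact: (PC 1) | exact: PM |].
elim: (k i) => [|j IHj]; first exact: (PC 1).
by rewrite exprS; apply: (PM).
Qed.

Lemma mderiv_prod_eq0 (I : Type) (r : seq I) (P : pred I)
    (f : I -> {mpoly F[n]}) k :
  (forall i, P i -> (f i)^`M(k) = 0) -> (\prod_(i <- r | P i) f i)^`M(k) = 0.
Proof.
move=> f0; apply: (big_ind (fun p => p^`M(k) = 0)) => [|p q p0 q0|i /f0 //].
  exact: mderivC.
by rewrite mderivM p0 q0 mul0r mulr0 addr0.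
Qed.

Lemma mderiv_comp_mpoly N (lq : n.-tuple {mpoly F[N]}) p k :
  (p \mPo lq)^`M(k) = \sum_s (p^`M(s) \mPo lq) * (tnth lq s)^`M(k).
Proof.
elim/mpoly_ind_mul: p => [c|i|p q IHp IHq|p q IHp IHq].
- rewrite comp_mpolyC mderivC big1 // => s _.
  by rewrite mderivC comp_mpoly0 mul0r.
- rewrite comp_mpolyXU -tnth_nth (bigD1 i) //= big1 => [|s /negPf si];
    rewrite mderivU.
    by rewrite eqxx comp_mpoly1 mul1r addr0.
  by rewrite eq_sym si comp_mpoly0 mul0r.
- rewrite !(comp_mpolyD, mderivD) IHp IHq -big_split; apply: eq_bigr => s _ /=.
  by rewrite mderivD comp_mpolyD mulrDl.
- rewrite rmorphM /= mderivM IHp IHq mulr_suml mulr_sumr -big_split.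
  by apply: eq_bigr => s _ /=; rewrite mderivM rmorphD !rmorphM /=; ring.
Qed.

End MpolyCalculus.

Lemma size_prod_XsubC_neq (R : idomainType) (T : finType) (f : T -> R) t :
  size (\prod_(r | r != t) ('X - (f r)%:P)) = #|T|.
Proof.
rewrite -big_enum size_prod_XsubC -cardE cardC1 prednK //.
by apply/card_gt0P; exists t.
Qed.

(** * Lagrange interpolation at the nodes z_s and the change to separated coordinates *)

Section Nodes.
Variables (F : fieldType) (N : nat) (z m : 'I_N.+1 -> F).
Hypothesis z_inj : injective z.

(** These are the A, As and B for which [D_h] with constant h reads A p'' - B p' + (sum_s h_s As)
    p. *)
Definition node_poly : {poly F} := \prod_s ('X - (z s)%:P).
Definition cofactor_poly s : {poly F} := \prod_(r | r != s) ('X - (z r)%:P).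
Definition weight_poly : {poly F} := \sum_s m s *: cofactor_poly s.

Local Notation A := node_poly.
Local Notation As := cofactor_poly.
Local Notation B := weight_poly.

Lemma node_polyE s : A = ('X - (z s)%:P) * As s.
Proof. by rewrite /A (bigD1 s). Qed.

Lemma size_cofactor_poly s : size (As s) = N.+1.
Proof.
by rewrite size_prod_XsubC_neq card_ord.
Qed.

Lemma cofactor_poly_monic s : As s \is monic.
Proof. exact: monic_prod_XsubC. Qed.

Lemma cofactor_poly_node s r : r != s -> (As s).[z r] = 0.
Proof.
by move=> rs; rewrite /As (bigD1 r) //= hornerM hornerXsubC subrr mul0r.
Qed.

Lemma cofactor_poly_neq0 s : (As s).[z s] != 0.
Proof.
rewrite horner_prod; apply/prodf_neq0 => r rs; rewrite hornerXsubC subr_eq0.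
by rewrite (inj_eq z_inj) eq_sym.
Qed.

Section Interpolation.
Variable n : nat.
Local Notation R := {mpoly F[n]}.
Local Notation mpC := (@mpolyC n F).

Lemma size_map_cofactor s : size (map_poly mpC (As s)) = N.+1.
Proof. by rewrite size_map_inj_poly ?size_cofactor_poly //; exact: fmorph_inj. Qed.

Lemma mpolyC_node_inj : injective (fun s => (z s)%:MP : R).
Proof. by move=> s r /fmorph_inj/z_inj. Qed.

Lemma lagrange_interpolation (G : {poly R}) : (size G <= N.+1)%N ->
  G = \sum_s (((As s).[z s])^-1 *: G.[(z s)%:MP]) *: map_poly mpC (As s).
Proof.
move=> sG; apply/eqP; rewrite -subr_eq0; apply/eqP.
set H := G - _.
apply: (@roots_geq_poly_eq0 _ H [seq (z s)%:MP | s <- enum 'I_N.+1]).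
- apply/allP => _ /mapP[s _ ->]; apply/rootP.
  rewrite /H hornerD hornerN horner_sum (bigD1 s) //= big1 => [|r rs].
    rewrite addr0 hornerZ horner_map /= -mul_mpolyC mulrAC -rmorphM /=.
    by rewrite mulVf ?cofactor_poly_neq0 // mul1r subrr.
  by rewrite hornerZ horner_map /= (@cofactor_poly_node r s) 1?eq_sym // mpolyC0 mulr0.
- by rewrite map_inj_uniq ?enum_uniq //; exact: mpolyC_node_inj.
- rewrite size_map size_enum_ord (leq_trans (size_polyD _ _)) //.
  rewrite geq_max sG size_polyN (leq_trans (size_sum _ _ _)) //.
  apply/bigmax_leqP => s _; rewrite (leq_trans (size_scale_leq _ _)) //.
  by rewrite size_map_cofactor.
Qed.

(** Compare the coefficients at degree N in the interpolation formula: the cofactors are monic of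
    degree N. *)
Lemma lagrange_coef (G : {poly R}) : (size G <= N.+1)%N ->
  \sum_s ((As s).[z s])^-1 *: G.[(z s)%:MP] = G`_N.
Proof.
move=> sG; rewrite [RHS](congr1 (fun p : {poly R} => p`_N) (lagrange_interpolation sG)).
rewrite coef_sum; apply: eq_bigr => s _; rewrite coefZ coef_map /=.
have /monicP := cofactor_poly_monic s.
by rewrite lead_coefE size_cofactor_poly => ->; rewrite mulr1.
Qed.

End Interpolation.

Local Notation R := {mpoly F[N]}.
Implicit Types (k : 'I_N) (s r : 'I_N.+1) (c : {poly F}) (v : {mpoly F[N.+1]}).

(** The value c(u_k), the variables of [R] being the separated coordinates u_k. *)
Definition at_var k c : R := horner_alg ('X_k : R) c.
HB.instance Definition _ k := GRing.RMorphism.copy (at_var k) (horner_alg ('X_k : R)).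

Lemma at_varZ k a c : at_var k (a *: c) = a *: at_var k c.
Proof.
rewrite -mul_polyC rmorphM /= {1}/at_var horner_algC alg_mpolyC.
by rewrite mul_mpolyC.
Qed.

Lemma at_varX k : at_var k 'X = 'X_k.
Proof. exact: horner_algX. Qed.

Lemma at_varC k a : at_var k a%:P = a%:MP.
Proof. by rewrite /at_var horner_algC alg_mpolyC. Qed.

Lemma at_varXsubC k s : at_var k ('X - (z s)%:P) = 'X_k - (z s)%:MP.
Proof. by rewrite rmorphB /= at_varX at_varC. Qed.

(* The separated coordinates u_1, ..., u_N of a point x of F^(N+1) with
   sum_s x_s = 1: they are the roots of sum_s x_s As(t). *)
Definition sep_coord s : R :=
  ((As s).[z s])^-1 *: \prod_k ((z s)%:MP - 'X_k).

(** The derivative of xi_s in u_k. It does not involve u_k, since xi_s is affine in each u_k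
    separately. *)
Definition sep_coord_deriv s k : R :=
  - ((As s).[z s])^-1 *: \prod_(k' | k' != k) ((z s)%:MP - 'X_k').

Local Notation xi := sep_coord.
Local Notation zeta := sep_coord_deriv.

Lemma sep_coordE s k : xi s = ('X_k - (z s)%:MP) * zeta s k.
Proof.
rewrite /xi (bigD1 k) //= /zeta -!mul_mpolyC rmorphN /=; ring.
Qed.

Lemma mderiv_sep_coord_deriv s k : (zeta s k)^`M(k) = 0.
Proof.
rewrite mderivZ mderiv_prod_eq0 ?scaler0 // => k' kk'.
by rewrite mderivB mderivC mderivU (negPf kk') subrr.
Qed.

Lemma mderiv_sep_coord s k : (xi s)^`M(k) = zeta s k.
Proof.
rewrite (sep_coordE s k) mderivM mderiv_sep_coord_deriv mulr0 addr0.
by rewrite mderivB mderivC mderivU eqxx subr0 mul1r.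
Qed.

(** By [lagrange_coef], the sum is minus the coefficient at degree N of the product of the t - u_k'
    with k' different from k, which has degree N - 1. It expresses that the xi_s have constant sum
    1. *)
Lemma sum_sep_coord_deriv k : \sum_s zeta s k = 0.
Proof.
pose G : {poly R} := \prod_(k' | k' != k) ('X - ('X_k')%:P).
have sG : size G = N.
  by rewrite size_prod_XsubC_neq card_ord.
have := @lagrange_coef N G; rewrite sG leqnSn => /(_ isT).
rewrite (nth_default _) ?sG // => H.
have zetaE s : zeta s k = - (((As s).[z s])^-1 *: G.[(z s)%:MP]).
  rewrite /zeta scaleNr [G.[_]]horner_prod; congr (- (_ *: _)).
  by apply: eq_bigr => k' _; rewrite hornerXsubC.
by under eq_bigr => s _ do rewrite zetaE; rewrite sumrN H oppr0.
Qed.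

(** Restriction of v to the hyperplane sum_s x_s = 1, written in the separated coordinates. *)
Definition separate v : R := v \mPo [tuple xi s | s < N.+1].
HB.instance Definition _ := GRing.LRMorphism.copy separate (comp_mpoly [tuple xi s | s < N.+1]).

Lemma separateU s : separate 'X_s = xi s.
Proof. by rewrite /separate comp_mpolyXU -tnth_nth tnth_mktuple. Qed.

Lemma mderiv_separate v k :
  (separate v)^`M(k) = \sum_s separate v^`M(s) * zeta s k.
Proof.
rewrite mderiv_comp_mpoly; apply: eq_bigr => s _.
by rewrite tnth_mktuple mderiv_sep_coord.
Qed.

(** The chain rule gives no first-order terms, because xi_s is affine in u_k. *)
Lemma mderiv2_separate v k : (separate v)^`M(k)^`M(k) =
  \sum_s \sum_r zeta s k * zeta r k * separate v^`M(s)^`M(r).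
Proof.
rewrite mderiv_separate raddf_sum; apply: eq_bigr => s _ /=.
rewrite mderivM mderiv_sep_coord_deriv mulr0 addr0 mderiv_separate mulr_suml.
by apply: eq_bigr => r _; ring.
Qed.

End Nodes.

(** * The Gaudin operators in separated coordinates *)

Section GaudinOperators.
Variables (F : fieldType) (n : nat) (z m : 'I_n -> F).
Implicit Types (s r : 'I_n) (v : {mpoly F[n]}).

(** The operator m_s m_r - Omega_{s,r} for distinct s and r. It vanishes at s = r, so sums over r !=
    s extend to all r. *)
Definition pair_op s r v : {mpoly F[n]} :=
  'X_s * 'X_r * (v^`M(s)^`M(s) + v^`M(r)^`M(r) - (v^`M(s)^`M(r)) *+ 2)
  - (m s *: 'X_r - m r *: 'X_s) * (v^`M(s) - v^`M(r)).

Lemma pair_opC s r v : pair_op s r v = pair_op r s v.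
Proof. rewrite /pair_op (mderiv_comm r s) -!mul_mpolyC; ring. Qed.

Lemma pair_opxx s v : pair_op s s v = 0.
Proof. rewrite /pair_op -!mul_mpolyC; ring. Qed.

Lemma Omega_pair_op s r v : s != r ->
  (m s * m r) *: v - Omega m s r v = pair_op s r v.
Proof.
move=> sr; have rs : (r == s) = false by rewrite eq_sym (negPf sr).
rewrite /Omega !big_ord_recl !big_ord0 /gl2_act /= /pair_op.
rewrite ?(mderivB, mderivD, mderivZ, mderivM, mderivU, eqxx, rs, negPf sr) /=.
rewrite ?(mderiv_comm r s) -?mul_mpolyC ?rmorphM /=; ring.
Qed.

Lemma HtildeE s v :
  Htilde z m s v = \sum_r (z s - z r)^-1 *: pair_op s r v.
Proof.
rewrite /Htilde big_mkcond /=; apply: eq_bigr => r _.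
case: eqVneq => [->|rs] /=; first by rewrite pair_opxx scaler0.
by rewrite Omega_pair_op // eq_sym.
Qed.

Hypothesis two_neq0 : 2%:R != 0 :> F.

(** Lets a double sum over s and r be replaced by its symmetrization. *)
Lemma eq_of_doubled (V : lmodType F) (u v : V) : u + u = v + v -> u = v.
Proof.
move=> e; apply: (scalerI two_neq0).
by rewrite !scaler_nat !mulr2n.
Qed.

(** [pair_op] is symmetric in s and r, whereas 1 / (z_s - z_r) is antisymmetric. *)
Lemma sum_Htilde v : \sum_s Htilde z m s v = 0.
Proof.
apply: eq_of_doubled; rewrite addr0.
under eq_bigr => s _ do rewrite HtildeE.
rewrite {2}exchange_big -big_split big1 //= => s _.
rewrite -big_split big1 //= => r _.
by rewrite (pair_opC r s) -scalerDl -(opprB (z s)) invrN addrN scale0r.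
Qed.

Lemma sum_sym_pairs (V : nmodType) (f : 'I_n -> 'I_n -> V) :
  \sum_s \sum_r (f s r + f r s) = (\sum_s \sum_r f s r) *+ 2.
Proof.
under eq_bigr => s _ do rewrite big_split /=.
by rewrite big_split /= [X in _ + X]exchange_big mulr2n.
Qed.

Hypothesis z_inj : injective z.

Lemma gl2_tot11 v : gl2_tot m 1 1 v = \sum_s 'X_s * v^`M(s).
Proof. by []. Qed.

Lemma gl2_tot10 v : gl2_tot m 1 0 v = (\sum_s 'X_s) * v.
Proof. by rewrite mulr_suml. Qed.

(* Up to the scalar part, this is the Casimir operator of the diagonal gl_2. *)
Lemma sum_z_Htilde (d : nat) v : gl2_tot m 1 1 v = d%:R *: v ->
  \sum_s z s *: Htilde z m s v =
    (d%:R * (\sum_s m s + 1 - d%:R)) *: v - gl2_tot m 1 0 (gl2_tot m 0 1 v).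
Proof.
move=> Ev; apply: eq_of_doubled; rewrite -[RHS]mulr2n.
(* After doubling, the factor (z_s - z_r) / (z_s - z_r) = 1 leaves the sum of all [pair_op s r v],
   and [pair_op s r v] is [a s r + a r s]. The sums of [a] are products of one-index sums, up to the
   mixed derivatives treated in [EEv]. *)
pose a s r := 'X_r * ('X_s * v^`M(s)^`M(s)) - 'X_s * 'X_r * v^`M(s)^`M(r)
  - 'X_r * (m s *: v^`M(s)) + m s *: ('X_r * v^`M(r)).
transitivity (\sum_s \sum_r (a s r + a r s)).
  transitivity (\sum_s \sum_r pair_op s r v).
    under eq_bigr => s _ do rewrite HtildeE scaler_sumr.
    rewrite {2}exchange_big -big_split; apply: eq_bigr => s _ /=.
    rewrite -big_split; apply: eq_bigr => r _ /=.
    rewrite (pair_opC r s) !scalerA -scalerDl -[z r - z s]opprB invrN mulrN.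
    rewrite -mulrBl; case: (eqVneq s r) => [->|sr].
      by rewrite pair_opxx scaler0.
    by rewrite mulfV ?scale1r // subr_eq0 (inj_eq z_inj).
  apply: eq_bigr => s _; apply: eq_bigr => r _.
  rewrite /a /pair_op (mderiv_comm r s) -!mul_mpolyC; ring.
rewrite sum_sym_pairs; congr (_ *+ 2).
(* With E the Euler operator, the left side is E (E v) - E v. *)
have EEv : \sum_s \sum_r 'X_s * 'X_r * v^`M(s)^`M(r) = (d%:R * (d%:R - 1)) *: v.
  have euler_deriv s :
      (\sum_r 'X_r * v^`M(r))^`M(s) = v^`M(s) + \sum_r 'X_r * v^`M(s)^`M(r).
    rewrite raddf_sum /=; under eq_bigr => r _ do rewrite mderivM mderivU.
    rewrite big_split /= (bigD1 s) //= eqxx mul1r big1 => [|r /negPf rs].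
      by rewrite addr0; congr (_ + _); apply: eq_bigr => r _; rewrite mderiv_comm.
    by rewrite rs mul0r.
  transitivity (gl2_tot m 1 1 (gl2_tot m 1 1 v) - gl2_tot m 1 1 v).
    rewrite !gl2_tot11 -sumrB; apply: eq_bigr => s _.
    rewrite euler_deriv mulrDr addrC addKr mulr_sumr.
    by apply: eq_bigr => r _; rewrite mulrA.
  by rewrite Ev linearZ /= Ev scalerA -scalerBl; congr (_ *: _); ring.
rewrite /a.
under eq_bigr => s _ do rewrite big_split /= !sumrB -!mulr_suml -scaler_sumr.
rewrite big_split /= !sumrB EEv -!mulr_sumr -scaler_suml.
rewrite -gl2_tot11 Ev gl2_tot10 /gl2_tot [in RHS]/gl2_act /= sumrB.
rewrite -!mul_mpolyC !(rmorphM, rmorphB, rmorphD, rmorph1) /=.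
ring.
Qed.

End GaudinOperators.

(** * Separation of variables for the Gaudin operators *)

Section SeparationOfVariables.
Variables (F : fieldType) (N : nat) (z m : 'I_N.+1 -> F).
Hypothesis z_inj : injective z.
Hypothesis two_neq0 : 2%:R != 0 :> F.
Implicit Types (s r : 'I_N.+1) (k : 'I_N) (v : {mpoly F[N.+1]}).

Definition pair_cofactor s r : {poly F} :=
  \prod_(i | (i != s) && (i != r)) ('X - (z i)%:P).

Lemma pair_cofactorC s r : pair_cofactor s r = pair_cofactor r s.
Proof. by apply: eq_bigl => i; rewrite andbC. Qed.

Lemma cofactor_polyE s r : s != r ->
  cofactor_poly z s = ('X - (z r)%:P) * pair_cofactor s r.
Proof. by move=> sr; rewrite /cofactor_poly (bigD1 r) 1?eq_sym. Qed.

(** Symmetrizing over pairs produces As(u_k) - Ar(u_k), which is divisible by z_s - z_r and so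
    cancels the denominators. The terms then assemble to derivatives in u_k by the chain rule, the
    others vanishing because the derivatives of the xi_s have sum 0. *)
Lemma separation_of_variables k v :
  at_var k (node_poly z) * (separate z v)^`M(k)^`M(k)
  - at_var k (weight_poly z m) * (separate z v)^`M(k)
  + \sum_s at_var k (cofactor_poly z s) * separate z (Htilde z m s v) = 0.
Proof.
set A := at_var k (node_poly z); set B := at_var k (weight_poly z m).
pose As s := at_var k (cofactor_poly z s).
pose zeta s := sep_coord_deriv z s k.
have AE s : A = ('X_k - (z s)%:MP) * As s by rewrite /A (node_polyE z s) rmorphM /= at_varXsubC.
(* Half of the contribution of the pair {s, r}: [b s r + b r s] is [pair_op] times the common factor
   of As and Ar at u_k, rewritten by xi_s = (u_k - z_s) zeta_s. *)
pose b s r := A * zeta s * zeta r *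
   (separate z v^`M(s)^`M(s) - separate z v^`M(s)^`M(r))
  - (m s *: As s) * zeta r * (separate z v^`M(s) - separate z v^`M(r)).
rewrite addrC; apply/eqP; rewrite addr_eq0; apply/eqP.
apply: (eq_of_doubled two_neq0); rewrite -[RHS]mulr2n.
transitivity (\sum_s \sum_r (b s r + b r s)).
  under eq_bigr => s _ do rewrite HtildeE raddf_sum mulr_sumr.
  rewrite {2}exchange_big -big_split; apply: eq_bigr => s _ /=.
  rewrite -big_split; apply: eq_bigr => r _ /=.
  rewrite !linearZ /= (pair_opC m r s) -!/(As _).
  case: (eqVneq s r) => [->|sr].
    by rewrite /b pair_opxx raddf0 !scaler0 mulr0 !subrr !mulr0 subrr addr0.
  have zsr : z s - z r != 0 by rewrite subr_eq0 (inj_eq z_inj).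
  set Q := at_var k (pair_cofactor s r).
  have Ass : As s = ('X_k - (z r)%:MP) * Q.
    by rewrite /As (cofactor_polyE sr) rmorphM /= at_varXsubC.
  have Asr : As r = ('X_k - (z s)%:MP) * Q.
    by rewrite /As (@cofactor_polyE r s) 1?eq_sym // pair_cofactorC rmorphM /= at_varXsubC.
  have -> : (z r - z s)^-1 = - (z s - z r)^-1 by rewrite -invrN opprB.
  rewrite scaleNr mulrN -!scalerAr -scalerBr -mulrBl Ass Asr.
  have -> : ('X_k - (z r)%:MP) * Q - ('X_k - (z s)%:MP) * Q = (z s - z r) *: Q.
    by rewrite -mul_mpolyC rmorphB /=; ring.
  rewrite scalerAl scalerA mulVf // scale1r /b (AE s) Ass Asr.
  rewrite /pair_op rmorphB !rmorphM /= !rmorphB !rmorphD /= !linearZ /=.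
  rewrite !separateU (sep_coordE z s k) (sep_coordE z r k) -!/(zeta _).
  rewrite (mderiv_comm r s) -!mul_mpolyC; ring.
rewrite sum_sym_pairs; congr (_ *+ 2).
have zeta0 : \sum_s zeta s = 0 by exact: sum_sep_coord_deriv.
have bE s : \sum_r b s r = m s *: As s * (separate z v)^`M(k)
    - A * \sum_r zeta s * zeta r * separate z v^`M(s)^`M(r).
  have -> : \sum_r b s r = \sum_r (zeta r * (A * zeta s * separate z v^`M(s)^`M(s)
      - m s *: As s * separate z v^`M(s)) + (m s *: As s * (separate z v^`M(r) * zeta r)
      - A * (zeta s * zeta r * separate z v^`M(s)^`M(r)))).
    by apply: eq_bigr => r _; rewrite /b; ring.
  rewrite big_split /= -mulr_suml zeta0 mul0r add0r sumrB -!mulr_sumr.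
  by rewrite -mderiv_separate.
under eq_bigr => s _ do rewrite bE.
rewrite sumrB -mulr_suml -mulr_sumr -(mderiv2_separate z v k) opprB.
have BE : B = \sum_s m s *: As s.
  rewrite /B /weight_poly raddf_sum; apply: eq_bigr => s _ /=.
  by rewrite at_varZ.
by rewrite BE.
Qed.

End SeparationOfVariables.

Lemma mcoeffXUM (F : fieldType) n (v : {mpoly F[n]}) s (k : 'X_{1..n}) :
  ('X_s * v)@_k = if k s == 0%N then 0 else v@_(k - U_(s)).
Proof.
case: ifP => [/eqP ks|/negbT ks].
  apply/memN_msupp_eq0/negP => /msuppM_le /allpairsP[[k1 k2] /=].
  rewrite msuppX inE => -[/eqP -> _ ek]; move: ks; rewrite ek.
  by rewrite mnmDE mnm1E eqxx.
by rewrite -{1}(submK (m' := k) (m := U_(s)%MM)) ?lep1mP // addmC mulrC mcoeffMX.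
Qed.

(** * Polynomials vanishing at all points, and Euler's identity *)

Section Kronecker.
Variables (n B : nat).

(** Uniqueness of digits in base B: the remainder modulo B gives the lowest one, the quotient the
    others. *)
Lemma digit_expansion_inj k (a b : nat -> nat) :
  (forall i, (i < k)%N -> (a i < B)%N /\ (b i < B)%N) ->
  (\sum_(i < k) a i * B ^ i = \sum_(i < k) b i * B ^ i)%N ->
  forall i, (i < k)%N -> a i = b i.
Proof.
elim: k a b => [|k IH] a b ab; first by [].
have [a0 b0] := ab 0%N isT; have B0 : (0 < B)%N by exact: leq_ltn_trans a0.
have step (c : nat -> nat) : (\sum_(i < k.+1) c i * B ^ i =
    (\sum_(i < k) c i.+1 * B ^ i) * B + c 0)%N.
  rewrite big_ord_recl /= expn0 muln1 addnC; congr (_ + _)%N.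
  rewrite big_distrl /=; apply: eq_bigr => i _.
  by rewrite /bump /= add1n expnSr mulnA.
rewrite !step => e.
have e0 : a 0%N = b 0%N.
  by have := congr1 (modn^~ B) e; rewrite !modnMDl !modn_small.
have := congr1 (divn^~ B) e; rewrite !divnMDl // !divn_small // !addn0.
move=> /(IH (fun i => a i.+1) (fun i => b i.+1)) H [//|i] ik.
by apply: H => // j jk; apply: (ab j.+1).
Qed.

End Kronecker.

Section Evaluation.
Variables (F : numFieldType).

Lemma poly_vanish (p : {poly F}) : (forall t, p.[t] = 0) -> p = 0.
Proof.
move=> p0; apply: (@roots_geq_poly_eq0 _ p [seq i%:R | i <- iota 0 (size p)]).
- by apply/allP => x _; apply/rootP.
- rewrite map_inj_uniq ?iota_uniq // => i j /eqP; rewrite eqr_nat.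
  by move/eqP.
- by rewrite size_map size_iota.
Qed.

(* Kronecker substitution. *)
Lemma mpoly_vanish n (v : {mpoly F[n]}) : (forall x, v.@[x] = 0) -> v = 0.
Proof.
move=> v0; pose B := msize v; pose code (k : 'X_{1..n}) := (\sum_(i < n) k i * B ^ i)%N.
have codeI k k' : k \in msupp v -> k' \in msupp v -> code k = code k' -> k = k'.
  move=> kv kv' e; apply/mnmP => i.
  pose ext (q : 'X_{1..n}) j := if insub j is Some j' then q j' else 0%N.
  have extE q (j : 'I_n) : ext q j = q j by rewrite /ext valK.
  rewrite -!extE; apply: (@digit_expansion_inj B n) => //.
    move=> j jn; have lt q : q \in msupp v -> (ext q j < B)%N.
      move=> qv; apply: (leq_ltn_trans _ (msize_mdeg_lt qv)).
      by rewrite -[j]/(val (Ordinal jn)) extE mdegE (bigD1 (Ordinal jn)) //= leq_addr.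
    by split; apply: lt.
  by under eq_bigr do rewrite extE; under [RHS]eq_bigr do rewrite extE.
pose p : {poly F} := \sum_(k <- msupp v) v@_k *: 'X^(code k).
have p0 : p = 0.
  apply: poly_vanish => t; rewrite -(v0 (fun i => t ^+ (B ^ i))) mevalE horner_sum.
  apply: eq_bigr => k _; rewrite hornerZ hornerXn; congr (_ * _).
  by rewrite -prodrXr; apply: eq_bigr => i _; rewrite -exprM mulnC.
apply/mpolyP => k; rewrite mcoeff0.
have [kv|/memN_msupp_eq0 //] := boolP (k \in msupp v).
have := congr1 (fun q : {poly F} => q`_(code k)) p0; rewrite coef0 coef_sum.
rewrite (bigD1_seq k) ?msupp_uniq //= coefZ coefXn eqxx mulr1 big1_seq ?addr0 //.
move=> k' /andP[kk' kv']; rewrite coefZ coefXn; case: eqVneq => [e|]; last by rewrite mulr0.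
by rewrite (codeI k k') ?eqxx // in kk'.
Qed.

Lemma meval_homog n l (v : {mpoly F[n]}) (y : F) x :
  v \is l.-homog -> v.@[fun i => y * x i] = y ^+ l * v.@[x].
Proof.
move=> /dhomogP vl; rewrite !mevalE mulr_sumr; apply: eq_big_seq => k kv.
under eq_bigr => i _ do rewrite exprMn.
by rewrite big_split /= prodrXr -mdegE (vl _ kv) mulrCA.
Qed.

(** The Euler operator multiplies each monomial by its degree, and distinct degrees remain distinct
    in characteristic 0. Thus the weight condition on singular vectors is homogeneity of degree
    l. *)
Lemma euler_homog n (m : 'I_n -> F) l (v : {mpoly F[n]}) :
  gl2_tot m 1 1 v = l%:R *: v <-> v \is l.-homog.
Proof.
have E k : (gl2_tot m 1 1 v)@_k = (mdeg k)%:R * v@_k.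
  rewrite gl2_tot11 raddf_sum mdegE natr_sum mulr_suml; apply: eq_bigr => s _ /=.
  rewrite mcoeffXUM; have [->|ks] := eqVneq (k s) 0%N; first by rewrite mul0r.
  rewrite mcoeff_deriv submK ?lep1mP // mnmBE mnm1E eqxx subn1 prednK ?lt0n //.
  by rewrite mulr_natl.
split=> [Ev|/dhomogP vl].
  apply/dhomogP => k; rewrite mcoeff_msupp => kv; have := E k; rewrite Ev mcoeffZ => /eqP.
  rewrite -subr_eq0 -mulrBl mulf_eq0 (negPf kv) orbF subr_eq0 eqr_nat.
  by move/eqP=> /esym.
apply/mpolyP => k; rewrite E mcoeffZ.
by have [kv|/memN_msupp_eq0->] := boolP (k \in msupp v); rewrite ?(vl _ kv) // !mulr0.
Qed.

End Evaluation.

Lemma mpolyXU_inj (F : fieldType) n : injective (fun i : 'I_n => 'X_i : {mpoly F[n]}).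
Proof.
move=> i j /(congr1 (mcoeff U_(i))); rewrite !mcoeffX eqxx.
case: eqVneq => [/mnmP/(_ i)|_ /eqP]; last by rewrite oner_eq0.
by rewrite !mnm1E eqxx; case: eqVneq.
Qed.

(** * Injectivity of the passage to separated coordinates *)

Section SeparationMap.
Variables (F : numClosedFieldType) (N : nat) (z : 'I_N.+1 -> F).
Hypothesis z_inj : injective z.
Local Notation R := {mpoly F[N]}.
Local Notation As := (cofactor_poly z).

Lemma at_varE (k : 'I_N) (c : {poly F}) :
  at_var k c = (map_poly (@mpolyC N F) c).['X_k].
Proof.
rewrite /at_var /horner_alg /horner_morph; congr (_.[_]).
by apply: eq_map_poly => a; rewrite /= alg_mpolyC.
Qed.

(** The polynomial G = sum_s w_s As has zero coefficient at degree N, hence degree below N, and has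
    the N distinct roots u_k. So G = 0, and its value at z_s is a nonzero multiple of w_s. This
    inverts the N equations of separation together with the equation for the sum. *)
Lemma cofactor_combination_eq0 (w : 'I_N.+1 -> R) :
  \sum_s w s = 0 -> (forall k, \sum_s at_var k (As s) * w s = 0) ->
  forall s, w s = 0.
Proof.
move=> w0 wk; pose G := \sum_s w s *: map_poly (@mpolyC N F) (As s).
suff G0 : G = 0.
  move=> s; have := congr1 (fun p : {poly R} => p.[(z s)%:MP]) G0.
  rewrite /G horner0 horner_sum (bigD1 s) //= big1 => [|r rs].
    rewrite addr0 hornerZ horner_map /= => /eqP; rewrite mulf_eq0.
    by rewrite mpolyC_eq0 (negPf (cofactor_poly_neq0 z_inj s)) orbF => /eqP.
  by rewrite hornerZ horner_map /= (@cofactor_poly_node _ _ _ r s) 1?eq_sym // mpolyC0 mulr0.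
apply: (@roots_geq_poly_eq0 _ G [seq 'X_k | k <- enum 'I_N]).
- apply/allP => _ /mapP[k _ ->]; apply/rootP.
  rewrite /G horner_sum -[RHS](wk k); apply: eq_bigr => s _.
  by rewrite hornerZ at_varE mulrC.
- by rewrite map_inj_uniq ?enum_uniq //; exact: mpolyXU_inj.
- rewrite size_map size_enum_ord; apply/leq_sizeP => j Nj; rewrite coef_sum.
  move: Nj; rewrite leq_eqVlt => /predU1P[<-|Nj].
    rewrite -[RHS]w0; apply: eq_bigr => s _; rewrite coefZ coef_map /=.
    have /monicP := cofactor_poly_monic z s.
    by rewrite lead_coefE size_cofactor_poly => ->; rewrite mulr1.
  rewrite big1 // => s _; rewrite coefZ coef_map /= nth_default ?mpolyC0 ?mulr0 //.
  by rewrite size_cofactor_poly.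
Qed.

Lemma meval_separate (v : {mpoly F[N.+1]}) (u : 'I_N -> F) :
  (separate z v).@[u] = v.@[fun s => ((As s).[z s])^-1 * \prod_k (z s - u k)].
Proof.
rewrite /separate comp_mpoly_meval; apply: meval_eq => s.
rewrite tnth_mktuple mevalZ rmorph_prod; congr (_ * _).
by apply: eq_bigr => k _; rewrite /= rmorphB /= mevalC mevalXU.
Qed.

(** A point x whose coordinates have a nonzero sum y is y times a point with separated coordinates,
    namely the roots of P_x, which exist over a closed field. By homogeneity v vanishes at x, so v
    times the sum of the variables vanishes everywhere. *)
Lemma separate_inj l (v : {mpoly F[N.+1]}) :
  v \is l.-homog -> separate z v = 0 -> v = 0.
Proof.
move=> vl v0; have : v * \sum_s 'X_s = 0.
  apply: mpoly_vanish => x; rewrite rmorphM rmorph_sum /=.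
  under eq_bigr => s _ do rewrite mevalXU.
  set y := \sum_s x s.
  have [->|y0] := eqVneq y 0; first by rewrite mulr0.
  suff -> : v.@[x] = 0 by rewrite mul0r.
  pose P : {poly F} := \sum_s x s *: As s.
  have P_node s : P.[z s] = x s * (As s).[z s].
    rewrite /P horner_sum (bigD1 s) //= big1 ?addr0 ?hornerZ // => r rs.
    by rewrite hornerZ (@cofactor_poly_node _ _ _ r s) 1?eq_sym // mulr0.
  have PN : P`_N = y.
    rewrite /P coef_sum; apply: eq_bigr => s _; rewrite coefZ.
    have /monicP := cofactor_poly_monic z s.
    by rewrite lead_coefE size_cofactor_poly => ->; rewrite mulr1.
  have sP : size P = N.+1.
    apply/eqP; rewrite eqn_leq; apply/andP; split.
      rewrite (leq_trans (size_sum _ _ _)) //; apply/bigmax_leqP => s _.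
      by rewrite (leq_trans (size_scale_leq _ _)) // size_cofactor_poly.
    by rewrite ltnNge; apply: contra y0 => /leq_sizeP/(_ N (leqnn N)) <-; rewrite PN.
  have [rs Prs] := closed_field_poly_normal P.
  have lP : lead_coef P = y by rewrite lead_coefE sP PN.
  have srs : size rs = N.
    by move: sP; rewrite Prs lP size_scale // size_prod_XsubC => -[].
  pose u (k : 'I_N) := rs`_k.
  have xE s : x s = y * (((As s).[z s])^-1 * \prod_k (z s - u k)).
    apply: (mulIf (cofactor_poly_neq0 z_inj s)); rewrite -P_node Prs lP hornerZ.
    rewrite -mulrA; congr (_ * _); rewrite mulrAC mulVf ?cofactor_poly_neq0 // mul1r.
    rewrite horner_prod (big_nth 0) srs big_mkord.
    by apply: eq_bigr => k _; rewrite hornerXsubC.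
  rewrite (meval_eq _ xE) (meval_homog _ _ vl) -meval_separate v0 meval0.
  by rewrite mulr0.
move/eqP; rewrite mulf_eq0 => /orP[/eqP //|/eqP e].
have := congr1 (fun p : {mpoly F[N.+1]} => p@_(U_(ord0))) e.
rewrite raddf_sum mcoeff0 (bigD1 ord0) //= mcoeffX eqxx big1 ?addr0.
  by move/eqP; rewrite oner_eq0.
move=> s /negPf s0; rewrite mcoeffX; case: eqVneq => // /mnmP/(_ s).
by rewrite !mnm1E eqxx eq_sym s0.
Qed.

End SeparationMap.

(** * Coefficients in one separated coordinate *)

HB.instance Definition _ (F : fieldType) n (z m : 'I_n -> F) s :=
  GRing.isLinear.Build F {mpoly F[n]} {mpoly F[n]} *:%R (Htilde z m s)
    (Htilde_linear z m s).

Section Slices.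
Variables (F : fieldType) (N : nat).
Implicit Types (k : 'I_N) (q : 'X_{1..N}) (f g : {mpoly F[N]}) (c : {poly F}).

Definition mnm_set q k i : 'X_{1..N} :=
  [multinom if j == k then i else q j | j < N].

Lemma mnm_setE q k i j : mnm_set q k i j = if j == k then i else q j.
Proof. by rewrite mnmE. Qed.

Lemma mnm_set_id q k : mnm_set q k (q k) = q.
Proof. by apply/mnmP => j; rewrite mnm_setE; case: eqVneq => [->|]. Qed.

Lemma mnm_setS q k i : (mnm_set q k i + U_(k))%MM = mnm_set q k i.+1.
Proof.
apply/mnmP => j; rewrite mnmDE !mnm_setE mnm1E eq_sym.
by case: eqVneq => _; rewrite ?addn1 ?addn0.
Qed.

(** View f as a polynomial in the variable of index k: this is its coefficient in F[X] at the
    monomial that q defines in the other variables. The degree in one variable is below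
    [msize f]. *)
Definition slice q k f : {poly F} := \poly_(i < msize f) f@_(mnm_set q k i).

Lemma coef_slice q k f i : (slice q k f)`_i = f@_(mnm_set q k i).
Proof.
rewrite coef_poly; case: ltnP => // fi.
apply/esym/memN_msupp_eq0/msize_mdeg_ge; rewrite (leq_trans fi) // mdegE.
by rewrite (bigD1 k) //= mnm_setE eqxx leq_addr.
Qed.

Fact slice_is_linear q k : linear (slice q k).
Proof.
by move=> a f g; apply/polyP => i; rewrite coefD coefZ !coef_slice mcoeffD mcoeffZ.
Qed.
HB.instance Definition _ q k :=
  GRing.isLinear.Build F {mpoly F[N]} {poly F} *:%R (slice q k) (slice_is_linear q k).

Lemma slice_deriv q k f : slice q k f^`M(k) = (slice q k f)^`().
Proof.
apply/polyP => i; rewrite coef_deriv !coef_slice mcoeff_deriv mnm_setS.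
by rewrite mnm_setE eqxx.
Qed.

Lemma slice_at_var q k c f : slice q k (at_var k c * f) = c * slice q k f.
Proof.
elim/poly_ind: c => [|c a IH]; first by rewrite rmorph0 !mul0r raddf0.
rewrite rmorphD rmorphM /= !mulrDl raddfD /=.
rewrite at_varX at_varC.
rewrite mul_mpolyC linearZ /= mul_polyC; congr (_ + _).
rewrite -mulrA mulrCA [RHS]mulrAC -IH.
apply/polyP => i; rewrite coefMX !coef_slice mcoeffXUM mnm_setE eqxx.
case: i => //= i; rewrite -[in LHS]mnm_setS.
by rewrite addmK.
Qed.

Definition var_degree_le k d f := forall q, (d < q k)%N -> f@_q = 0.

Lemma var_degree_leM k d e f g :
  var_degree_le k d f -> var_degree_le k e g -> var_degree_le k (d + e) (f * g).
Proof.
move=> fd ge q dq; apply/memN_msupp_eq0/negP => /msuppM_le /allpairsP[[q1 q2] /= [fq gq eq]].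
move: dq; rewrite eq mnmDE ltnNge leq_add //.
  by move: fq; rewrite mcoeff_msupp leqNgt; apply: contraNN => /fd ->.
by move: gq; rewrite mcoeff_msupp leqNgt; apply: contraNN => /ge ->.
Qed.

Lemma var_degree_leC k a : var_degree_le k 0 (a%:MP).
Proof.
move=> q; rewrite mcoeffC; case: eqVneq => [->|_ _]; first by rewrite mnm0E.
by rewrite mulr0.
Qed.

Lemma var_degree_le_prod k (I : eqType) (r : seq I) (d : I -> nat) (f : I -> {mpoly F[N]}) :
  (forall i, i \in r -> var_degree_le k (d i) (f i)) ->
  var_degree_le k (\sum_(i <- r) d i)%N (\prod_(i <- r) f i).
Proof.
elim: r => [|i r IH] fd; first by rewrite !big_nil -mpolyC1; exact: var_degree_leC.
rewrite !big_cons; apply: var_degree_leM; first by apply: fd; rewrite mem_head.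
by apply: IH => j jr; apply: fd; rewrite in_cons jr orbT.
Qed.

Lemma var_degree_leX k d f i : var_degree_le k d f -> var_degree_le k (i * d) (f ^+ i).
Proof.
move=> fd; elim: i => [|i IH]; first by rewrite expr0 -mpolyC1; exact: var_degree_leC.
by rewrite exprS mulSn; apply: var_degree_leM.
Qed.

Lemma var_degree_leZ k d a f : var_degree_le k d f -> var_degree_le k d (a *: f).
Proof. by move=> fd q dq; rewrite mcoeffZ fd // mulr0. Qed.

Lemma var_degree_sep_coord (z : 'I_N.+1 -> F) k s : var_degree_le k 1 (sep_coord z s).
Proof.
apply: var_degree_leZ.
have -> : 1%N = (\sum_(k' < N) (k' == k))%N.
  by rewrite (bigD1 k) //= eqxx big1 ?addn0 // => j /negPf->.
apply: var_degree_le_prod => j _ q jq; rewrite mcoeffB mcoeffC mcoeffX.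
have -> : (q == 0%MM) = false by apply: contraTF jq => /eqP->; rewrite mnm0E.
have -> : (U_(j)%MM == q) = false.
  by apply: contraTF jq => /eqP<-; rewrite mnm1E ltnn.
by rewrite mulr0 subr0.
Qed.

(** Each xi_s has degree at most 1 in u_k, and v has degree l in the x_s. *)
Lemma var_degree_separate (z : 'I_N.+1 -> F) l v k :
  v \is l.-homog -> var_degree_le k l (separate z v).
Proof.
move=> /dhomogP vl q lq; rewrite /separate comp_mpolyEX raddf_sum /=.
apply: big1_seq => r /= rv; rewrite mcoeffZ comp_mpolyX.
have := @var_degree_le_prod k _ (index_enum 'I_N.+1) (fun i => r i).
have -> : (\sum_i r i)%N = l by rewrite -mdegE (vl _ rv).
move=> ->; rewrite ?mulr0 // => i _; rewrite tnth_mktuple.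
by rewrite -[X in var_degree_le k X]muln1; apply: var_degree_leX; exact: var_degree_sep_coord.
Qed.

End Slices.

(** * The matrix of the differential operator near its top degree *)

Section TopCoefficients.
Variables (F : fieldType) (N : nat) (z m : 'I_N.+1 -> F).
Local Notation A := (node_poly z).
Local Notation As := (cofactor_poly z).
Local Notation B := (weight_poly z m).
Implicit Types (i j : nat) (s : 'I_N.+1).

(* The matrix of p |-> A p'' - B p' + (sum_s h_s As) p in the monomial basis
   has entries deriv_entry i j + sum_s h_s cofactor_entry s i j. *)
Definition deriv_entry i j : F := (A * ('X^i)^`(2) - B * ('X^i)^`())`_j.
Definition cofactor_entry s i j : F := (As s * 'X^i)`_j.

Lemma poly_sum_coef l (p : {poly F}) :
  (forall i, (l < i)%N -> p`_i = 0) -> p = \sum_(i < l.+1) p`_i *: 'X^i.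
Proof.
move=> pl; have sp : (size p <= l.+1)%N by apply/leq_sizeP.
by rewrite -poly_def; apply/polyP => i; rewrite coef_poly; case: ltnP => // /pl.
Qed.

Lemma deriv_entryE l (p : {poly F}) j : (forall i, (l < i)%N -> p`_i = 0) ->
  (A * p^`(2) - B * p^`())`_j = \sum_(i < l.+1) p`_i * deriv_entry i j.
Proof.
move/poly_sum_coef => {1 2}->.
rewrite derivnS /= !linear_sum /= !mulr_sumr -sumrB coef_sum.
apply: eq_bigr => i _; rewrite !linearZ /= -!scalerAr -scalerBr coefZ.
by rewrite /deriv_entry derivnS.
Qed.

Lemma cofactor_entryE l (p : {poly F}) s j : (forall i, (l < i)%N -> p`_i = 0) ->
  (As s * p)`_j = \sum_(i < l.+1) p`_i * cofactor_entry s i j.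
Proof.
move/poly_sum_coef => {1}->; rewrite mulr_sumr coef_sum.
by apply: eq_bigr => i _; rewrite -scalerAr coefZ.
Qed.

Lemma size_node_poly : size A = N.+2.
Proof. by rewrite size_prod_XsubC -[index_enum _]enumT size_enum_ord. Qed.

Lemma coef_cofactor_top s : (As s)`_N = 1.
Proof.
by have /monicP := cofactor_poly_monic z s; rewrite lead_coefE size_cofactor_poly.
Qed.

Lemma coef_cofactor_high s j : (N < j)%N -> (As s)`_j = 0.
Proof. by move=> Nj; rewrite nth_default // size_cofactor_poly. Qed.

Lemma coef_cofactor_subtop s : (0 < N)%N ->
  (As s)`_N.-1 = z s - \sum_r z r.
Proof.
move=> N0; have : size [seq z r | r <- enum (predC1 s)] = N.
  by rewrite size_map -cardE cardC1 card_ord.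
move=> sz; have := @coefPn_prod_XsubC F [seq z r | r <- enum (predC1 s)].
rewrite sz -lt0n => /(_ N0).
rewrite !big_map !big_enum /= => ->.
by rewrite [in RHS](bigD1 s) //= opprD addrA subrr add0r.
Qed.

Lemma coef_weight_high j : (N < j)%N -> B`_j = 0.
Proof.
move=> Nj; rewrite coef_sum big1 // => s _.
by rewrite coefZ coef_cofactor_high ?mulr0.
Qed.

Lemma coef_weight_top : B`_N = \sum_s m s.
Proof.
rewrite coef_sum; apply: eq_bigr => s _.
by rewrite coefZ coef_cofactor_top mulr1.
Qed.

Lemma deriv_entry_expand i j : deriv_entry i j =
  (i * i.-1)%:R * (if (j < i - 2)%N then 0 else A`_(j - (i - 2)))
  - i%:R * (if (j < i.-1)%N then 0 else B`_(j - i.-1)).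
Proof.
rewrite /deriv_entry derivnXn derivXn coefB !mulrnAr !coefMn !coefMXn.
by rewrite ffactnS ffactn1 -[X in X - _]mulr_natl -[X in _ - X]mulr_natl.
Qed.

Lemma deriv_entry_high i j : (i + N <= j)%N -> deriv_entry i j = 0.
Proof.
move=> ij; rewrite deriv_entry_expand.
have -> : (j < i - 2)%N = false by lia.
have -> : (j < i.-1)%N = false by lia.
case: i ij => [|i] ij; first by rewrite mul0n !mul0r subr0.
rewrite coef_weight_high ?mulr0 ?subr0 /=; last by lia.
case: i ij => [|i] ij; first by rewrite muln0 mul0r.
by rewrite [A`_ _]nth_default ?mulr0 // size_node_poly; lia.
Qed.

Lemma deriv_entry_top i j : (j.+1 = i + N)%N ->
  deriv_entry i j = i%:R * (i%:R - 1) - i%:R * \sum_s m s.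
Proof.
move=> ij; rewrite deriv_entry_expand.
case: i ij => [|i] ij; first by rewrite mul0n !mul0r.
rewrite -(natr1 i) addrK.
have -> : (j < i.+1 - 2)%N = false by lia.
have -> : (j < i)%N = false by lia.
have -> : (j - i = N)%N by lia.
rewrite coef_weight_top natrM -natr1; congr (_ - _).
case: i ij => [|i] ij; first by rewrite mulr0 mul0r.
have -> : (j - (i.+2 - 2) = N.+1)%N by lia.
have /monicP : A \is monic by exact: monic_prod_XsubC.
by rewrite lead_coefE size_node_poly => ->; rewrite mulr1.
Qed.

Lemma cofactor_entry_expand s i j :
  cofactor_entry s i j = if (j < i)%N then 0 else (As s)`_(j - i).
Proof. exact: coefMXn. Qed.

Section Entry.
Variables (V : lmodType F) (x : V) (h : 'I_N.+1 -> V) (l : nat).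
Local Notation M := (\sum_s m s).
Hypothesis sum_h : \sum_s h s = 0.
Hypothesis sum_zh : \sum_s z s *: h s = (l%:R * (M + 1 - l%:R)) *: x.

(** The h_s live in an arbitrary module with x as unit, so that the same matrix serves over C[a, h],
    over [A_D] and over the endomorphisms of Sing. The hypotheses [sum_h] and [sum_zh] are the
    relations q_(-1) = 0 and q_0 = 0. *)
Definition entry i j : V :=
  deriv_entry i j *: x + \sum_s cofactor_entry s i j *: h s.

(** The indicial polynomial of the differential equation at infinity; l is a root of it. *)
Definition top_entry i : F :=
  i%:R * (i%:R - 1) - i%:R * M + l%:R * (M + 1 - l%:R).

(** At j = i + N only the leading coefficients 1 of the cofactors remain, and the h_s have sum 0. *)
Lemma entry_high i j : (i + N <= j)%N -> entry i j = 0.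
Proof.
move=> ij; rewrite /entry deriv_entry_high // scale0r add0r.
move: ij; rewrite leq_eqVlt => /predU1P[<-|ij].
  rewrite -[RHS]sum_h; apply: eq_bigr => s _.
  by rewrite cofactor_entry_expand ltnNge leq_addr /= addKn coef_cofactor_top scale1r.
rewrite big1 // => s _; rewrite cofactor_entry_expand.
by case: ltnP => _; rewrite ?coef_cofactor_high ?scale0r //; lia.
Qed.

(** By Vieta, h_s occurs with the coefficient z_s - sum_r z_r. The second term drops out as the h_s
    have sum 0, and the first gives the scalar of [sum_zh]. *)
Lemma entry_top i j : (j.+1 = i + N)%N -> entry i j = top_entry i *: x.
Proof.
move=> ij; rewrite /entry deriv_entry_top // /top_entry [in RHS]scalerDl.
have E s : cofactor_entry s i j = z s - \sum_r z r.
  rewrite cofactor_entry_expand.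
  (* For N = 0 the degree j = i - 1 lies below i, so the entry is 0; so is z_s - sum_r z_r, there
     being a single node. *)
  have [N0|N0] := posnP N.
    have -> : (j < i)%N by lia.
    rewrite (bigD1 s) //= big1 ?addr0 ?subrr // => r; rewrite -val_eqE /=.
    by have := ltn_ord r; have := ltn_ord s; lia.
  have -> : (j < i)%N = false by lia.
  have -> : (j - i = N.-1)%N by lia.
  exact: coef_cofactor_subtop.
rewrite -sum_zh; congr (_ + _).
have -> : \sum_s cofactor_entry s i j *: h s =
    \sum_s (z s *: h s - (\sum_r z r) *: h s).
  by apply: eq_bigr => s _; rewrite E scalerBl.
by rewrite sumrB -scaler_sumr sum_h scaler0 subr0.
Qed.

Lemma top_entry_self : top_entry l = 0.
Proof. rewrite /top_entry; ring. Qed.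

(** [top_entry i] factors as (l - i) (M - 2 l + 1 + (l - i)), and separation at the index l - i
    excludes that the second factor vanishes. *)
Lemma top_entry_neq0 i : separating l m -> (forall k, k.+1%:R != 0 :> F) ->
  (i < l)%N -> top_entry i != 0.
Proof.
move=> sep char0 il; have [k lE] : exists k, l = (i + k.+1)%N by exists (l - i).-1; lia.
have : (1 <= k.+1 <= l)%N by lia.
move=> /sep; set c := (X in X != 0) => c0.
suff -> : top_entry i = k.+1%:R * c by rewrite mulf_neq0 // char0.
rewrite /c /top_entry lE natrM !natrD; ring.
Qed.

End Entry.

End TopCoefficients.

(** * Coefficients of the separated equations, and commutativity of the Gaudin operators *)

Section SeparatedGaudin.
Variables (F : numClosedFieldType) (N : nat) (z m : 'I_N.+1 -> F).
Hypothesis z_inj : injective z.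
Implicit Types (s r : 'I_N.+1) (k : 'I_N) (v : {mpoly F[N.+1]}) (f : {mpoly F[N]}).
Local Notation H := (Htilde z m).
Local Notation As k s := (at_var k (cofactor_poly z s)).

Let two_neq0 : 2%:R != 0 :> F. Proof. by rewrite pnatr_eq0. Qed.

Lemma Htilde_homog l v s : v \is l.-homog -> H s v \is l.-homog.
Proof.
move=> /(euler_homog m) Ev; apply/(euler_homog m).
by rewrite Htilde_gl2_tot Ev linearZ.
Qed.

(** The coefficient of u_k^j in [separation_of_variables], the exponents of the other coordinates
    being fixed by q. It has the shape of the coefficient at x^j of D_h p = 0. *)
Lemma separated_relation l v k q j : v \is l.-homog ->
  \sum_(i < l.+1) (deriv_entry z m i j * (separate z v)@_(mnm_set q k i)
    + \sum_s cofactor_entry z s i j * (separate z (H s v))@_(mnm_set q k i)) = 0.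
Proof.
move=> vl; pose S v := slice q k (separate z v).
have Sl w : w \is l.-homog -> forall i, (l < i)%N -> (S w)`_i = 0.
  move=> wl i li; rewrite coef_slice; apply: (var_degree_separate z (k := k) wl).
  by rewrite mnm_setE eqxx.
have e : (node_poly z * (S v)^`(2) - weight_poly z m * (S v)^`())`_j
    + \sum_s (cofactor_poly z s * S (H s v))`_j = 0.
  have := congr1 (fun f => (slice q k f)`_j) (separation_of_variables m z_inj two_neq0 k v).
  rewrite !(raddfD (slice q k)) (raddfN (slice q k)) (raddf_sum (slice q k)).
  rewrite raddf0 /= !slice_at_var !slice_deriv coefD coef_sum coef0 => e; rewrite -[RHS]e.
  by congr (_ + _); apply: eq_bigr => s _; rewrite slice_at_var.
rewrite -[RHS]e (deriv_entryE z m j (Sl v vl)).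
under [X in _ = _ + X]eq_bigr => s _ do
  rewrite (cofactor_entryE z s j (Sl _ (Htilde_homog s vl))).
rewrite exchange_big -big_split /=; apply: eq_bigr => i _.
rewrite coef_slice mulrC; congr (_ + _); apply: eq_bigr => s _.
by rewrite coef_slice mulrC.
Qed.

(** The differential part of the separated equation; it acts in u_k alone. *)
Definition sep_op k f : {mpoly F[N]} :=
  at_var k (node_poly z) * f^`M(k)^`M(k) - at_var k (weight_poly z m) * f^`M(k).

Lemma sep_opE k v : \sum_s As k s * separate z (H s v) = - sep_op k (separate z v).
Proof.
by apply/eqP; rewrite -addr_eq0 addrC; apply/eqP; exact: separation_of_variables.
Qed.

Lemma mderiv_at_var k k' (c : {poly F}) : k != k' -> (at_var k' c)^`M(k) = 0.
Proof.
move=> kk'; elim/poly_ind: c => [|c a IH]; first by rewrite raddf0 mderiv0.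
rewrite rmorphD rmorphM /= at_varX at_varC mderivD mderivM mderivC IH mderivU.
by rewrite eq_sym (negPf kk') mul0r mulr0 !addr0.
Qed.

Lemma sep_op_at_var k k' (c : {poly F}) f : k != k' ->
  sep_op k (at_var k' c * f) = at_var k' c * sep_op k f.
Proof.
move=> kk'; rewrite /sep_op !(mderivM, mderivD) !(mderiv_at_var _ kk') mderiv0.
ring.
Qed.

Fact sep_op_is_linear k : linear (sep_op k).
Proof.
by move=> a f g; rewrite /sep_op !(mderivD, mderivZ) -!mul_mpolyC; ring.
Qed.
HB.instance Definition _ k :=
  GRing.isLinear.Build F {mpoly F[N]} {mpoly F[N]} *:%R (sep_op k) (sep_op_is_linear k).

Lemma sep_op_comm k k' f : k != k' -> sep_op k (sep_op k' f) = sep_op k' (sep_op k f).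
Proof.
have expand k1 k2 : k1 != k2 -> sep_op k1 (sep_op k2 f) =
    at_var k2 (node_poly z) * sep_op k1 (f^`M(k2)^`M(k2))
    - at_var k2 (weight_poly z m) * sep_op k1 (f^`M(k2)).
  by move=> k12; rewrite [sep_op k2 f]/sep_op raddfB /= !sep_op_at_var.
move=> kk'; rewrite (expand _ _ kk') (expand k') 1?eq_sym // /sep_op.
by rewrite !(mderiv_comm k' k); ring.
Qed.

(* The H_s are obtained by inverting the system of the commuting operators
   sep_op k, as in the separation of variables of a multiparameter eigenvalue
   problem; hence they commute as well. *)
Lemma Htilde_comm l v s r : v \is l.-homog -> H s (H r v) = H r (H s v).
Proof.
move=> vl; pose w s r := separate z (H s (H r v)) - separate z (H r (H s v)).
have wC s' r' : w s' r' = - w r' s' by rewrite /w opprB.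
(* For k = k' this is the antisymmetry of w; for distinct k and k' it is the commutation of
   [sep_op k] with [sep_op k']. Two applications of [cofactor_combination_eq0], one for each index,
   then give w = 0. *)
have double k k' : \sum_r \sum_s As k s * (As k' r * w s r) = 0.
  have [<-|kk'] := eqVneq k k'.
    apply: (eq_of_doubled two_neq0); rewrite addr0 {2}exchange_big -big_split.
    rewrite big1 //= => i _; rewrite -big_split big1 //= => j _.
    by rewrite (wC j i) mulrCA -mulrDr -mulrDr addNr !mulr0.
  have one k1 k2 : k1 != k2 -> \sum_r \sum_s As k1 s * (As k2 r * separate z (H s (H r v)))
      = sep_op k1 (sep_op k2 (separate z v)).
    move=> k12; transitivity (\sum_r As k2 r * - sep_op k1 (separate z (H r v))).
      apply: eq_bigr => j _; rewrite -sep_opE mulr_sumr.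
      by apply: eq_bigr => i _; rewrite mulrCA.
    rewrite -[sep_op k2 _]opprK -sep_opE (raddfN (sep_op k1)) /= (raddf_sum (sep_op k1)) /= -sumrN.
    by apply: eq_bigr => j _; rewrite sep_op_at_var // mulrN.
  transitivity (sep_op k (sep_op k' (separate z v)) - sep_op k' (sep_op k (separate z v))).
    rewrite -(one k k') // -(one k' k) 1?eq_sym // [X in _ - X]exchange_big -sumrB.
    apply: eq_bigr => j _; rewrite -sumrB; apply: eq_bigr => i _.
    by rewrite /w !mulrBr; congr (_ - _); rewrite mulrCA.
  by rewrite sep_op_comm // subrr.
have w_sum i : \sum_j w i j = 0.
  have e1 : \sum_j separate z (H i (H j v)) = 0.
    transitivity (separate z (H i (\sum_j H j v))).
      by rewrite (raddf_sum (H i)) (raddf_sum (separate z)).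
    by rewrite (sum_Htilde z m two_neq0) (raddf0 (H i)) (raddf0 (separate z)).
  have e2 : \sum_j separate z (H j (H i v)) = 0.
    transitivity (separate z (\sum_j H j (H i v))).
      by rewrite (raddf_sum (separate z)).
    by rewrite (sum_Htilde z m two_neq0) (raddf0 (separate z)).
  transitivity (\sum_j separate z (H i (H j v)) - \sum_j separate z (H j (H i v))).
    exact: sumrB.
  by rewrite [X in X - _]e1 [X in _ - X]e2 subr0.
have row k j : \sum_i As k i * w i j = 0.
  apply: (cofactor_combination_eq0 z_inj (w := fun j => \sum_i As k i * w i j)).
    rewrite exchange_big big1 //= => i _.
    by rewrite -mulr_sumr w_sum mulr0.
  move=> k'; rewrite -[RHS](double k k'); apply: eq_bigr => j' _.
  by rewrite mulr_sumr; apply: eq_bigr => i _; rewrite mulrCA.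
have w0 : w s r = 0.
  apply: (cofactor_combination_eq0 z_inj (w := fun s => w s r)) => [|k]; last exact: row.
  by under eq_bigr => i _ do rewrite wC; rewrite sumrN w_sum oppr0.
apply/eqP; rewrite -subr_eq0; apply/eqP; apply: (separate_inj z_inj (l := l)).
  by rewrite rpredB // !Htilde_homog.
by rewrite (raddfB (separate z)).
Qed.

End SeparatedGaudin.

(** * The universal weight function in separated coordinates *)

Lemma coef_prod_at_vars (T : comNzRingType) N (P : {poly T}) (q : 'X_{1..N}) :
  (\prod_(k < N) (map_poly (@mpolyC N T) P).['X_k])@_q = \prod_(k < N) P`_(q k).
Proof.
pose d := maxn (size P) (mdeg q).+1.
have qd k : (q k < d)%N.
  by rewrite leq_max ltnS orbC mdegE (bigD1 k) //= leq_addr.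
have PE k : (map_poly (@mpolyC N T) P).['X_k] = \sum_(i < d) P`_i *: 'X_k ^+ i.
  rewrite (@horner_coef_wide _ d) ?(leq_trans (size_poly _ _)) ?leq_maxl //.
  by apply: eq_bigr => i _; rewrite coef_map mul_mpolyC.
under eq_bigr => k _ do rewrite PE.
rewrite bigA_distr_bigA raddf_sum /=.
have E (f : {ffun 'I_N -> 'I_d}) : (\prod_k (P`_(f k) *: 'X_k ^+ f k))@_q
    = (\prod_k P`_(f k)) * ([multinom val (f k) | k < N] == q)%:R.
  rewrite scaler_prod mcoeffZ -mcoeffX; congr (_ * mcoeff _ _).
  by rewrite mpolyXE_id; apply: eq_bigr => k _; rewrite mnmE.
rewrite (bigD1 [ffun k => Ordinal (qd k)]) //= E.
have -> : [multinom val ([ffun k => Ordinal (qd k)] k) | k < N] = q.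
  by apply/mnmP => k; rewrite mnmE ffunE.
rewrite eqxx mulr1 [X in _ + X]big1 => [|f fq].
  by rewrite addr0; apply: eq_bigr => k _; rewrite ffunE.
rewrite E; case: eqVneq => [e|]; last by rewrite mulr0.
case/eqP: fq; apply/ffunP => k; apply/val_inj; rewrite ffunE /=.
by rewrite -e mnmE.
Qed.

Lemma dualZ (F : comNzRingType) (V : lmodType F) (g : dual V) c x :
  g (c *: x) = c * g x.
Proof. by rewrite [LHS](linearZ_LR (g : Defs.hom V F^o)). Qed.

Section WeightFunction.
Variables (F : fieldType) (N l : nat) (z m : 'I_N.+1 -> F).
Hypothesis z_inj : injective z.
Local Notation T := {mpoly F[l]}.
Local Notation TN := {mpoly {mpoly F[l]}[N]}.

Let toT : {mpoly F[N]} -> TN := map_mpoly (@mpolyC l F).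
Let sepT (v : {mpoly T[N.+1]}) : TN := v \mPo [tuple toT (sep_coord z s) | s < N.+1].

Lemma sep_coord_interpolation :
  \prod_(k < N) ('X - ('X_k : {mpoly F[N]})%:P) =
  \sum_s sep_coord z s *: map_poly (@mpolyC N F) (cofactor_poly z s).
Proof.
rewrite [LHS](lagrange_interpolation z_inj); last first.
  by rewrite size_prod_XsubC -[index_enum _]enumT size_enum_ord.
apply: eq_bigr => s _; congr ((_ *: _) *: _); rewrite horner_prod.
by apply: eq_bigr => k _; rewrite hornerXsubC.
Qed.

(** The j-th factor of omega is P_x(t_j), which [sep_coord_interpolation] turns into the product of
    the t_j - u_k. *)
Lemma omega_t_separated :
  sepT (omega_t l z) = \prod_(j < l) \prod_(k < N) (('X_j)%:MP - 'X_k).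
Proof.
rewrite /sepT /omega_t rmorph_prod; apply: eq_bigr => j _ /=.
have := congr1 (fun p => (map_poly toT p).[('X_j)%:MP]) sep_coord_interpolation.
rewrite rmorph_prod rmorph_sum /= horner_prod horner_sum => e.
transitivity (\prod_k (map_poly toT ('X - ('X_k)%:P)).[('X_j)%:MP]).
  rewrite e rmorph_sum; apply: eq_bigr => s _ /=.
  rewrite comp_mpolyZ comp_mpolyXU -tnth_nth tnth_mktuple -mul_mpolyC mulrC.
  rewrite map_polyZ /= hornerZ; congr (_ * _).
  rewrite /cofactor_poly !rmorph_prod horner_prod; apply: eq_bigr => r _ /=.
  by rewrite !map_polyXsubC hornerXsubC /= map_mpolyC mpolyCB.
by apply: eq_bigr => k _; rewrite map_polyXsubC hornerXsubC /= map_mpolyX.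
Qed.

(** Interchanging the products groups the factors into (-1)^l p(u_k), one for each of the N
    coordinates. *)
Lemma coef_omega_t_separated q : (sepT (omega_t l z))@_q =
  (-1) ^+ (l * N) * \prod_(k < N) (\prod_(j < l) ('X - ('X_j : T)%:P))`_(q k).
Proof.
rewrite -coef_prod_at_vars omega_t_separated exchange_big /=.
have E (k : 'I_N) : \prod_(j < l) (('X_j)%:MP - 'X_k) =
    ((-1) ^+ l)%:MP * (map_poly (@mpolyC N T) (\prod_(j < l) ('X - ('X_j)%:P))).['X_k].
  transitivity (\prod_(j < l) - ('X_k - ('X_j)%:MP : TN)).
    by apply: eq_bigr => j _; rewrite opprB.
  rewrite prodrN card_ord rmorphXn rmorphN1 rmorph_prod horner_prod; congr (_ * _).
  by apply: eq_bigr => j _; rewrite /= map_polyXsubC hornerXsubC.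
under eq_bigr => k _ do rewrite E.
by rewrite big_split /= prodr_const card_ord -rmorphXn -exprM mcoeffCM.
Qed.

Let sepT_X (k : 'X_{1..N.+1}) : sepT 'X_[k] = toT (separate z 'X_[k]).
Proof.
rewrite /sepT /separate !comp_mpolyX /toT rmorph_prod; apply: eq_bigr => s _.
by rewrite !tnth_mktuple /= rmorphXn.
Qed.

Lemma coef_omega_t_sum w q : (msize (omega_t l z) <= w)%N ->
  (sepT (omega_t l z))@_q =
  \sum_(k : 'X_{1..N.+1 < w}) (separate z 'X_[k])@_q *: (omega_t l z)@_k.
Proof.
move=> sw; rewrite {1}(mpolywE sw) /sepT (raddf_sum (comp_mpoly _)) (raddf_sum (mcoeff q)) /=.
apply: eq_bigr => k _; rewrite comp_mpolyZ -/(sepT _) mcoeffZ sepT_X mcoeff_map_mpoly.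
by rewrite mulrC mul_mpolyC.
Qed.

Let elem_to_a (c : T) : {mpoly F[l + N.+1]} :=
  c \mPo [tuple (-1) ^+ i.+1 *: avar F N.+1 i | i < l].

(** The polynomial p with the variables of [T] in the role of the elementary symmetric functions. It
    becomes [p_a] under [elem_to_a], and the product of the X - t_i under the substitution of the
    elementary symmetric polynomials. *)
Let p_e : {poly T} :=
  'X^l + \sum_(i < l) ((-1) ^+ i.+1 *: 'X_i) *: 'X^(l - i.+1).

Let p_e_a : map_poly elem_to_a p_e = p_a F N.+1 l.
Proof.
rewrite /p_e rmorphD rmorph_sum /= map_polyXn; congr (_ + _).
apply: eq_bigr => i _; rewrite map_polyZ map_polyXn; congr (_ *: _).
rewrite /= /elem_to_a comp_mpolyZ comp_mpolyXU -tnth_nth tnth_mktuple scalerA.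
by rewrite -exprMn mulrNN mulr1 expr1n scale1r.
Qed.

Local Notation S := [tuple mesym l F i.+1 | i < l].

Let p_e_t : map_poly (comp_mpoly S) p_e = \prod_(i < l) ('X - ('X_i : T)%:P).
Proof.
rewrite -(p_a_of_t F N.+1 l) /p_e /p_a !rmorphD !rmorph_sum /= !map_polyXn.
congr (_ + _); apply: eq_bigr => i _; rewrite !map_polyZ !map_polyXn /=.
by congr (_ *: _); rewrite avar_a_of_t comp_mpolyZ comp_mpolyXU -tnth_nth tnth_mktuple.
Qed.

Lemma coef_tau (g : dual (A_D l z m)) k :
  (tau_fun g)@_k = g (pi_D z m (omega_a l z)@_k).
Proof.
rewrite /tau_fun raddf_sum /=.
have [ko|ko] := boolP (k \in msupp (omega_a l z)).
  rewrite (bigD1_seq k) ?msupp_uniq //= mcoeffZ mcoeffX eqxx mulr1.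
  rewrite big1 ?addr0 // => k' /negPf kk'.
  by rewrite mcoeffZ mcoeffX kk' mulr0.
rewrite (memN_msupp_eq0 ko) /pi_D raddf0 (raddf0 (g : Defs.hom _ _)) big1_seq //= => k' ok'.
rewrite mcoeffZ mcoeffX; case: eqVneq => [e|]; last by rewrite mulr0.
by rewrite -e ok' in ko.
Qed.

Lemma coef_omega_a k : (omega_a l z)@_k = elem_to_a (symf (omega_t l z)@_k).
Proof.
by rewrite /omega_a mcoeff_map_mpoly0 // /sym_to_a /symf symfnE0 comp_mpoly0.
Qed.

(** In separated coordinates omega is, up to sign, the product of the p(u_k), so its coefficient at
    u^q is a product of coefficients of p. *)
Lemma separate_tau (g : dual (A_D l z m)) q : (separate z (tau_fun g))@_q =
  (-1) ^+ (l * N) * g (pi_D z m (\prod_(k < N) (p_a F N.+1 l)`_(q k))).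
Proof.
pose w := maxn (msize (tau_fun g)) (msize (omega_t l z)).
rewrite {1}(mpolywE (leq_maxl _ _ : (msize (tau_fun g) <= w)%N)) (raddf_sum (separate z)) (raddf_sum (mcoeff q)) /=.
pose c k := (separate z 'X_[k])@_q.
transitivity (g (pi_D z m (\sum_(k : 'X_{1..N.+1 < w}) c k *: (omega_a l z)@_k))).
  rewrite /pi_D (raddf_sum (quot_pi _)) (raddf_sum (g : Defs.hom _ _)); apply: eq_bigr => k _ /=.
  by rewrite linearZ /= mcoeffZ coef_tau /pi_D linearZ dualZ mulrC.
have -> : \sum_(k : 'X_{1..N.+1 < w}) c k *: (omega_a l z)@_k =
    (-1) ^+ (l * N) *: \prod_(k < N) (p_a F N.+1 l)`_(q k).
  transitivity (elem_to_a (\sum_(k : 'X_{1..N.+1 < w}) c k *: symf (omega_t l z)@_k)).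
    rewrite /elem_to_a (raddf_sum (comp_mpoly _)); apply: eq_bigr => k _ /=.
    by rewrite coef_omega_a comp_mpolyZ.
  transitivity (elem_to_a ((-1) ^+ (l * N) *: \prod_(k < N) p_e`_(q k))); last first.
    rewrite /elem_to_a comp_mpolyZ rmorph_prod; congr (_ *: _).
    by apply: eq_bigr => k _; rewrite -p_e_a coef_map.
  (* The elementary symmetric polynomials are algebraically independent, so it suffices to compare
     after substituting them, that is, in C[t]. *)
  congr elem_to_a; apply: msym_fundamental_un.
  rewrite (raddf_sum (comp_mpoly _)) comp_mpolyZ rmorph_prod /=.
  transitivity (\sum_(k : 'X_{1..N.+1 < w}) c k *: (omega_t l z)@_k).
    by apply: eq_bigr => k _; rewrite comp_mpolyZ -symfP ?omega_t_sym.
  rewrite -coef_omega_t_sum ?leq_maxr // coef_omega_t_separated -mul_mpolyC.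
  rewrite rmorphXn rmorphN1 -p_e_t; congr (_ * _).
  by apply: eq_bigr => k _; rewrite coef_map.
by rewrite /pi_D linearZ dualZ.
Qed.

Lemma tau_homog (g : dual (A_D l z m)) : tau_fun g \is l.-homog.
Proof.
apply/dhomogP => k; rewrite mcoeff_msupp coef_tau coef_omega_a.
apply: contraNeq => kl.
have oh : omega_t l z \is l.-homog.
  pose f (j : 'I_l) : {mpoly T[N.+1]} := \sum_s (\prod_(i | i != s) ('X_j - (z i)%:MP)) *: 'X_s.
  have f1 j : f j \is 1.-homog.
    by apply: rpred_sum => s _; apply: rpredZ; rewrite dhomogX /= mdeg1.
  have := @dhomog_prod _ _ _ l [tuple 1%N | j < l] [tuple f j | j < l].
  have -> : (\sum_(i <- [tuple 1%N | j < l]) i)%N = l.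
    rewrite big_tuple; under eq_bigr => j _ do rewrite tnth_mktuple.
    by rewrite sum1_card card_ord.
  rewrite big_tuple; under eq_bigr => j _ do rewrite tnth_mktuple.
  by apply=> j; rewrite !tnth_mktuple.
have -> : (omega_t l z)@_k = 0 by exact: (dhomog_nemf_coeff oh).
by rewrite /symf symfnE0 /elem_to_a comp_mpoly0 /pi_D raddf0 (raddf0 (g : Defs.hom _ _)).
Qed.

End WeightFunction.

(** * The algebra A_D *)

Section AlgebraD.
Variables (F : fieldType) (N l : nat) (z m : 'I_N.+1 -> F).
Local Notation n := N.+1.
Local Notation RD := {mpoly F[l + n]}.
Local Notation mpC := (@mpolyC (l + n) F).
Local Notation alpha i := ((p_a F n l)`_i).
Local Notation pi := (pi_D z m).

Lemma p_a_coef_high i : (l < i)%N -> alpha i = 0.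
Proof.
move=> li; rewrite coefD coefXn gtn_eqF // add0r coef_sum big1 // => j _.
by rewrite coefZ coefXn gtn_eqF ?mulr0 //; lia.
Qed.

Lemma p_a_coef_top : alpha l = 1.
Proof.
rewrite coefD coefXn eqxx coef_sum big1 ?addr0 // => j _.
by rewrite coefZ coefXn gtn_eqF ?mulr0 //; have := ltn_ord j; lia.
Qed.

Lemma p_a_coef_avar (j : 'I_l) : alpha (l - j.+1) = avar F n j.
Proof.
rewrite coefD coefXn ltn_eqF ?add0r; last by have := ltn_ord j; lia.
rewrite coef_sum (bigD1 j) //= coefZ coefXn eqxx mulr1 big1 ?addr0 // => i ij.
rewrite coefZ coefXn (_ : _ == _ = false) ?mulr0 //.
apply: contraNF ij => /eqP e; apply/eqP/val_inj => /=.
by have := ltn_ord i; have := ltn_ord j; lia.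
Qed.

Lemma D_h_Xn i : D_h z m ('X^i : {poly RD}) =
  map_poly mpC (node_poly z * ('X^i)^`(2) - weight_poly z m * ('X^i)^`())
  + \sum_s hvar F l s *: map_poly mpC (cofactor_poly z s * 'X^i).
Proof.
have cofE s : \prod_(r | r != s) ('X - ((z r)%:MP)%:P) = map_poly mpC (cofactor_poly z s).
  by rewrite rmorph_prod; apply: eq_bigr => r _ /=; rewrite map_polyXsubC.
rewrite /D_h rmorphB !rmorphM /= -!deriv_map map_polyXn.
congr (_ * _ - _ * _ + _).
- by rewrite rmorph_prod; apply: eq_bigr => r _ /=; rewrite map_polyXsubC.
- rewrite rmorph_sum; apply: eq_bigr => s _ /=.
  by rewrite cofE map_polyZ.
- rewrite mulr_suml; apply: eq_bigr => s _.
  by rewrite cofE rmorphM /= map_polyXn scalerAl.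
Qed.

Lemma D_h_coef j : (D_h z m (p_a F n l))`_j =
  \sum_(i < l.+1) alpha i * entry z m (1 : RD) (hvar F l) i j.
Proof.
have sp : (size (p_a F n l) <= l.+1)%N.
  by apply/leq_sizeP => i; exact: p_a_coef_high.
have -> : D_h z m (p_a F n l) = \sum_(i < l.+1) alpha i *: D_h z m 'X^i.
  have {1}-> : p_a F n l = \sum_(i < l.+1) alpha i *: 'X^i.
    rewrite -poly_def; apply/polyP => i; rewrite coef_poly.
    by case: ltnP => // /p_a_coef_high.
  rewrite /D_h derivnS /= !linear_sum /= !mulr_sumr -sumrB -big_split.
  apply: eq_bigr => i _ /=; rewrite !linearZ /= -!scalerAr -scalerBr -scalerDr.
  by [].
rewrite coef_sum; apply: eq_bigr => i _; rewrite coefZ; congr (_ * _).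
rewrite D_h_Xn coefD coef_map coef_sum /entry /deriv_entry -mul_mpolyC mulr1; congr (_ + _).
apply: eq_bigr => s _.
by rewrite coefZ coef_map /= -mul_mpolyC mulrC.
Qed.

Lemma pi_D_scale c (f : RD) : pi (c *: f) = c *: pi f.
Proof. by rewrite /pi_D linearZ. Qed.

Lemma pi_D_mul (f g : RD) : pi (f * g) = pi f * pi g.
Proof. exact: quot_piM. Qed.

Lemma pi_D1 : pi (1 : RD) = 1.
Proof. by []. Qed.

Lemma A_D_scalerAr c (f g : A_D l z m) : f * (c *: g) = c *: (f * g).
Proof. by have := quot_lmul_subproof f c g 0; rewrite mulr0 !addr0. Qed.

Lemma pi_q_D (j : 'I_(l + n - 2).+2) : pi (@q_D F n l z m j) = 0.
Proof.
rewrite -(raddf0 (quot_pi (@q_D F n l z m))); apply/quot_piE; rewrite subr0.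
apply/asboolP; exists (fun i => (i == j)%:R); rewrite (bigD1 j) //= eqxx mul1r.
by rewrite big1 ?addr0 // => i /negPf->; rewrite mul0r.
Qed.

Lemma sum_h_D : \sum_s h_D l z m s = 0.
Proof.
have := pi_q_D (Ordinal (isT : (0 < (l + n - 2).+2)%N)).
by rewrite /q_D /= /pi_D (raddf_sum (quot_pi _)).
Qed.

Lemma sum_z_h_D :
  \sum_s z s *: h_D l z m s =
  (l%:R * (\sum_s m s + 1 - l%:R)) *: (1 : A_D l z m).
Proof.
have := pi_q_D (Ordinal (isT : (1 < (l + n - 2).+2)%N)).
rewrite /q_D /= /pi_D (raddfB (quot_pi _)) (raddf_sum (quot_pi _)) /=.
move=> /eqP; rewrite subr_eq0 -alg_mpolyC linearZ /= => /eqP.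
rewrite rmorph1 => <-; apply: eq_bigr => s _.
by rewrite linearZ.
Qed.

(** The generators q_1, q_2, ... cover only the degrees j < l + n - 2. In higher degrees every entry
    vanishes by q_(-1) and q_0, the one at i = l and j = l + N - 1 because l is a root of
    [top_entry]. *)
Lemma A_D_relation j :
  \sum_(i < l.+1) pi (alpha i) * entry z m (1 : A_D l z m) (h_D l z m) i j = 0.
Proof.
have pi_entry i : pi (entry z m (1 : RD) (hvar F l) i j) =
    entry z m (1 : A_D l z m) (h_D l z m) i j.
  rewrite /entry [LHS](raddfD (quot_pi _)) (raddf_sum (quot_pi _)).
  congr (_ + _); first by rewrite [LHS]pi_D_scale /pi_D rmorph1.
  by apply: eq_bigr => s _; rewrite [LHS]pi_D_scale.
have [jl|lj] := ltnP j (l + n - 2).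
  have ik : ((l + n - 2 - j).+1 < (l + n - 2).+2)%N by lia.
  have := pi_q_D (Ordinal ik); rewrite /q_D /=.
  have -> : (l + n - 2 - j = (l + n - 2 - j).-1.+1)%N by lia.
  rewrite (_ : (l + n - 2 - _)%N = j); last by lia.
  rewrite D_h_coef /pi_D (raddf_sum (quot_pi _)) => e; rewrite -[RHS]e.
  by apply: eq_bigr => i _; rewrite -pi_entry -pi_D_mul.
apply: big1 => i _; have := ltn_ord i; rewrite ltnS => il.
have [iN|iN] := leqP (i + N) j; first by rewrite (entry_high _ _ _ sum_h_D) ?mulr0.
have il' : i = l :> nat by lia.
rewrite (entry_top sum_h_D sum_z_h_D) ?il' ?top_entry_self ?scale0r ?mulr0 //.
by lia.
Qed.

Hypothesis char0 : forall k, k.+1%:R != 0 :> F.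
Hypothesis sep : separating l m.

(** At degree i + N - 1 the relation of [A_D] contains the i-th coefficient of p with the nonzero
    scalar [top_entry i], and otherwise only higher coefficients. Hence all a_i are polynomials in
    the h_s. *)
Lemma A_D_generated (S : A_D l z m -> Prop) :
  S 1 -> (forall c f g, S f -> S g -> S (c *: f + g)) ->
  (forall f g, S f -> S g -> S (f * g)) -> (forall s, S (h_D l z m s)) ->
  forall f, S f.
Proof.
move=> S1 SD SM Sh.
have S0 : S 0 by rewrite -(addNr 1) -scaleN1r; apply: (SD).
have SZ c f : S f -> S (c *: f) by move=> Sf; rewrite -[_ *: _]addr0; apply: (SD).
have SA f g : S f -> S g -> S (f + g) by move=> Sf Sg; rewrite -[f]scale1r; apply: (SD).
have Ssum (I : eqType) (r : seq I) (f : I -> A_D l z m) :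
    (forall i, i \in r -> S (f i)) -> S (\sum_(i <- r) f i).
  elim: r => [|i r IH] Sf; first by rewrite big_nil.
  rewrite big_cons; apply: (SA); first by apply: Sf; rewrite mem_head.
  by apply: IH => j jr; apply: Sf; rewrite in_cons jr orbT.
have Sentry i j : S (entry z m (1 : A_D l z m) (h_D l z m) i j).
  by apply: (SA); [apply: (SZ) | apply: (Ssum) => s _; apply: (SZ)].
(* For N = 0 and i = 0 there is no degree i + N - 1. In this case the only h_s is 0, and q_0 makes a
   nonzero scalar vanish in [A_D], which is therefore zero. *)
have [trivial|nontrivial] := pselect (N = 0%N /\ (0 < l)%N).
  move=> f; suff -> : f = 0 by [].
  case: trivial => N0 l0; rewrite -[f]mul1r.
  suff -> : (1 : A_D l z m) = 0 by rewrite mul0r.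
  have c0 : top_entry m l 0 != 0 by exact: top_entry_neq0.
  have : top_entry m l 0 *: (1 : A_D l z m) = 0.
    rewrite /top_entry !mul0r subr0 add0r -sum_z_h_D big1 // => s _.
    have -> : h_D l z m s = \sum_r h_D l z m r.
      rewrite (bigD1 s) //= big1 ?addr0 // => r rs; case/eqP: rs.
      by apply/val_inj; have := ltn_ord r; have := ltn_ord s => /=; lia.
    by rewrite sum_h_D scaler0.
  by move/(congr1 (fun x => (top_entry m l 0)^-1 *: x)); rewrite scalerA mulVf // scale1r scaler0.
have Salpha k : (k <= l)%N -> S (pi (alpha (l - k))).
  elim/ltn_ind: k => k IH kl.
  have [->|k0] := posnP k; first by rewrite subn0 p_a_coef_top /pi_D rmorph1.
  set i := (l - k)%N; pose j := (i + N).-1.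
  have jE : j.+1 = (i + N)%N by rewrite /j prednK //; lia.
  have il : (i < l.+1)%N by lia.
  have c0 : top_entry m l i != 0 by apply: top_entry_neq0 => //; lia.
  have := A_D_relation j; rewrite (bigD1 (Ordinal il)) //=.
  rewrite (entry_top sum_h_D sum_z_h_D) // => /eqP; rewrite addr_eq0 => /eqP e.
  suff : S (top_entry m l i *: pi (alpha i)).
    by move/(SZ (top_entry m l i)^-1); rewrite scalerA mulVf // scale1r.
  move: e; rewrite A_D_scalerAr mulr1 => ->.
  rewrite -scaleN1r; apply: (SZ); rewrite big_mkcond /=; apply: (Ssum) => i' _.
  case: eqVneq => //= ii'.
  have [lt|le] := ltnP i' i.
    by rewrite (entry_high _ _ _ sum_h_D) ?mulr0 //; lia.
  apply: (SM) => //; rewrite (_ : nat_of_ord i' = l - (l - i'))%N; last first.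
    by have := ltn_ord i'; lia.
  have : nat_of_ord i' != i by apply: contraNneq ii' => e'; apply/eqP/val_inj.
  by move=> ?; apply: IH; have := ltn_ord i'; lia.
move=> f; rewrite -(quot_reprK f); move: (repr f) => {f}.
elim/mpoly_ind_mul => [c|i|p q Sp Sq|p q Sp Sq].
- by rewrite -alg_mpolyC linearZ rmorph1; apply: (SZ).
- rewrite -(splitK i); case: (split i) => [j|s] /=; last exact: Sh.
  have := Salpha j.+1 (ltn_ord j); rewrite p_a_coef_avar.
  by [].
- by rewrite raddfD; apply: (SA).
- by rewrite rmorphM; apply: (SM).
Qed.

End AlgebraD.

(** * The map tau *)

Section DualLemmas.
Variables (F : comNzRingType) (V : lmodType F).
Implicit Types (g h : dual V) (x y : V).

Lemma dualD g x y : g (x + y) = g x + g y.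
Proof. exact: (raddfD (g : Defs.hom V F^o)). Qed.

Lemma dual0 g : g 0 = 0.
Proof. exact: (raddf0 (g : Defs.hom V F^o)). Qed.

Lemma dual_sum g I (r : seq I) (P : pred I) (f : I -> V) :
  g (\sum_(i <- r | P i) f i) = \sum_(i <- r | P i) g (f i).
Proof. exact: (raddf_sum (g : Defs.hom V F^o)). Qed.

End DualLemmas.

Section Tau.
Variables (F : numClosedFieldType) (N l : nat) (z m : 'I_N.+1 -> F).
Hypothesis z_inj : injective z.
Local Notation n := N.+1.
Local Notation AD := (A_D l z m).
Local Notation H := (Htilde z m).
Local Notation alpha i := ((p_a F n l)`_i).
Implicit Types (g : dual AD) (s : 'I_n).

Lemma tau_fun_linear : linear (@tau_fun F n l z m).
Proof.
by move=> c g h; apply/mpolyP => k; rewrite mcoeffD mcoeffZ !coef_tau.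
Qed.
HB.instance Definition _ :=
  GRing.isLinear.Build F (dual AD) {mpoly F[n]} *:%R (@tau_fun F n l z m) tau_fun_linear.

Let two_neq0 : 2%:R != 0 :> F. Proof. by rewrite pnatr_eq0. Qed.

Lemma A_D_scalerAl c (f g : AD) : (c *: f) * g = c *: (f * g).
Proof. by rewrite mulrC A_D_scalerAr mulrC. Qed.

Lemma coef_at_var_mul k (c : {poly F}) (f : {mpoly F[N]}) q :
  (at_var k c * f)@_q = (c * slice q k f)`_(q k).
Proof. by rewrite -slice_at_var coef_slice mnm_set_id. Qed.

Lemma prod_alpha_set (k : 'I_N) q i : \prod_(k' < N) alpha (mnm_set q k i k') =
  alpha i * \prod_(k' < N | k' != k) alpha (q k').
Proof.
rewrite (bigD1 k) //= mnm_setE eqxx; congr (_ * _).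
by apply: eq_bigr => k' /negPf kk'; rewrite mnm_setE kk'.
Qed.

(** Both sides, as families in s, have sum 0 and satisfy the same separated equations, the left by
    [separated_relation] and the right by [A_D_relation]. The difference vanishes by
    [cofactor_combination_eq0]. *)
Lemma Htilde_tau g s :
  H s (tau_fun g) = tau_fun (transpose (L_D (h_D l z m s)) g).
Proof.
pose gs s := transpose (L_D (h_D l z m s)) g.
have gsE r x : gs r x = g (h_D l z m r * x) by [].
apply/eqP; rewrite -subr_eq0; apply/eqP.
apply: (separate_inj z_inj (l := l)).
  by rewrite rpredB ?Htilde_homog ?tau_homog.
apply: (cofactor_combination_eq0 z_inj
  (w := fun s => separate z (H s (tau_fun g) - tau_fun (gs s)))) => [|k].
  transitivity (separate z (\sum_s (H s (tau_fun g) - tau_fun (gs s)))).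
    by rewrite (raddf_sum (separate z)).
  have gs0 : \sum_s tau_fun (gs s) = 0.
    apply/mpolyP => q; rewrite raddf_sum mcoeff0 /=.
    transitivity (\sum_s g (h_D l z m s * pi_D z m (omega_a l z)@_q)).
      by apply: eq_bigr => r _; rewrite coef_tau.
    by rewrite -dual_sum -mulr_suml sum_h_D mul0r dual0.
  by rewrite sumrB sum_Htilde // gs0 subr0 (raddf0 (separate z)).
apply/mpolyP => q; rewrite mcoeff0 raddf_sum /=; set j := q k.
have deg_le v : v \is l.-homog -> forall i, (l < i)%N -> (slice q k (separate z v))`_i = 0.
  move=> vl i li; rewrite coef_slice; apply: (var_degree_separate z (k := k) vl).
  by rewrite mnm_setE eqxx.
pose C v i := (separate z v)@_(mnm_set q k i).
have E s' v : v \is l.-homog -> (at_var k (cofactor_poly z s') * separate z v)@_q =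
    \sum_(i < l.+1) cofactor_entry z s' i j * C v i.
  move=> vl; rewrite coef_at_var_mul (cofactor_entryE z s' _ (deg_le v vl)).
  by apply: eq_bigr => i _; rewrite coef_slice mulrC.
transitivity (\sum_(i < l.+1) (\sum_s' cofactor_entry z s' i j * C (H s' (tau_fun g)) i
    - \sum_s' cofactor_entry z s' i j * C (tau_fun (gs s')) i)).
  under [RHS]eq_bigr => i _ do rewrite -sumrB.
  rewrite exchange_big; apply: eq_bigr => s' _.
  rewrite raddfB mulrBr mcoeffB !E ?Htilde_homog ?tau_homog // -sumrB.
  by apply: eq_bigr.
have := separated_relation m z_inj k q j (tau_homog g).
rewrite big_split /= => /eqP; rewrite addrC addr_eq0 => /eqP e.
rewrite sumrB e -opprD -big_split /=.
(* By [separate_tau], varying the exponent of u_k changes only one factor under the functional; P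
   collects the others. What remains is g applied to P times a relation of [A_D]. *)
pose P := \prod_(k' < N | k' != k) alpha (q k').
have CE (h : dual AD) i : C (tau_fun h) i =
    (-1) ^+ (l * N) * h (pi_D z m (alpha i) * pi_D z m P).
  by rewrite /C separate_tau // prod_alpha_set pi_D_mul.
transitivity (- ((-1) ^+ (l * N) * g ((\sum_(i < l.+1)
    pi_D z m (alpha i) * entry z m (1 : AD) (h_D l z m) i j) * pi_D z m P))); last first.
  by rewrite A_D_relation mul0r dual0 mulr0 oppr0.
congr (- _); rewrite mulr_suml dual_sum mulr_sumr; apply: eq_bigr => i _.
rewrite /entry mulrDr mulrDl dualD mulrDr; congr (_ + _).
  rewrite -/(C _ _) CE A_D_scalerAr mulr1 A_D_scalerAl dualZ.
  by rewrite mulrCA.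
rewrite mulr_sumr mulr_suml dual_sum mulr_sumr; apply: eq_bigr => s' _.
rewrite CE gsE A_D_scalerAr A_D_scalerAl dualZ mulrA mulrCA.
by rewrite (mulrC (pi_D z m (alpha i))) !mulrA (mulrC _ (cofactor_entry _ _ _ _)).
Qed.

(** By q_0, sum_s z_s Htilde_s acts on [tau_fun g] by the scalar of [sum_z_Htilde], so e_21 e_12
    kills [tau_fun g]. As e_21 is multiplication by the sum of the variables, it is injective. *)
Lemma tau_sing g : tau_fun g \in sing_pred l m.
Proof.
have Ev := euler_homog m l (tau_fun g); have {Ev}Ev := (Ev.2 (tau_homog g)).
rewrite unfold_in Ev eqxx andbT.
have := sum_z_Htilde two_neq0 z_inj Ev.
under eq_bigr => s _ do rewrite Htilde_tau -linearZ /=.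
have -> : \sum_s tau_fun (z s *: transpose (L_D (h_D l z m s)) g) =
    tau_fun ((l%:R * (\sum_s m s + 1 - l%:R)) *: g).
  apply/mpolyP => q; rewrite raddf_sum coef_tau /=; set x := pi_D z m _.
  transitivity (g ((\sum_s z s *: h_D l z m s) * x)).
    rewrite mulr_suml dual_sum; apply: eq_bigr => s _.
    by rewrite coef_tau mulrC A_D_scalerAr mulrC dualZ.
  by rewrite sum_z_h_D mulrC A_D_scalerAr mulr1 dualZ.
rewrite linearZ /= => /eqP; rewrite -subr_eq0 opprB addrC addrNK.
rewrite gl2_tot10 mulf_eq0 => /orP[/eqP e|//].
have := congr1 (fun p : {mpoly F[N.+1]} => p@_(U_(ord0))) e.
rewrite raddf_sum mcoeff0 (bigD1 ord0) //= mcoeffX eqxx big1 ?addr0.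
  by move/eqP; rewrite oner_eq0.
move=> s /negPf s0; rewrite mcoeffX; case: eqVneq => // /mnmP/(_ s).
by rewrite !mnm1E eqxx eq_sym s0.
Qed.

End Tau.

(** * Linear functionals separate points *)

Section DualSeparation.
Variables (F : fieldType) (V : lmodType F).

Definition subspace (U : V -> Prop) := forall c u v, U u -> U v -> U (c *: u + v).

(* Zorn: a subspace maximal among those avoiding x is a hyperplane complementary
   to x; the functional is the coordinate along x. *)
Lemma dual_separates (x : V) : x != 0 -> exists g : dual V, g x != 0.
Proof.
move=> x0; pose P (U : V -> Prop) := subspace U /\ ~ U x.
have [C CP Ctot|U [[sU Ux] maxU]] := @classical_sets.Zorn_bigcup V P.
  split=> [c u v [A CA Au] [B CB Bv]|[A CA Ax]]; last by case: (CP A CA) => _; apply.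
  have [AB|BA] := Ctot A B CA CB; [exists B => // | exists A => //].
    by apply: (CP B CB).1 => //; apply: AB.
  by apply: (CP A CA).1 => //; apply: BA.
have U0 : U 0.
  apply: contrapT => nU0; apply: (maxU (fun v => v = 0)).
    split=> [v Uv|/(_ 0 erefl) //]; case: nU0.
    by rewrite -(addNr v) -scaleN1r; apply: sU.
  by split=> [c u v -> ->|/eqP e]; [rewrite scaler0 addr0 | rewrite (negPf x0) in e].
have decomp v : exists c, U (v - c *: x).
  have [Uv|nUv] := pselect (U v); first by exists 0; rewrite scale0r subr0.
  (* B is the span of U and v; it is larger than U and so contains x by maximality. *)
  pose B w := exists2 c, U (w - c *: v) & True.
  have Bx : B x.
    apply: contrapT => nBx; apply: (maxU B).
      split=> [u Uu|/(_ v) BU].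
        by exists 0 => //; rewrite scale0r subr0.
      by apply: nUv; apply: BU; exists 1 => //; rewrite scale1r subrr.
    split=> // c u w [a Ua _] [b Ub _]; exists (c * a + b) => //.
    have -> : c *: u + w - (c * a + b) *: v = c *: (u - a *: v) + (w - b *: v).
      by rewrite scalerBr scalerDl scalerA opprD addrACA.
    exact: sU.
  case: Bx => c Uc _; have c0 : c != 0.
    by apply: contra_notN Ux => /eqP c0; rewrite -[x]subr0 -(scale0r v) -c0.
  exists c^-1; have := sU (- c^-1) _ _ Uc U0.
  rewrite addr0 scalerBr !scaleNr opprK scalerA mulVf // scale1r addrC.
  by [].
have uniq c d v : U (v - c *: x) -> U (v - d *: x) -> c = d.
  move=> Uc Ud; apply/eqP; rewrite -subr_eq0; apply: contra_notT Ux => cd.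
  have := sU (- (c - d)^-1) _ _ (sU (-1) _ _ Ud Uc) U0.
  rewrite addr0 scaleN1r opprB addrA addrNK -scalerBl.
  by rewrite scalerA mulNr -mulrN opprB mulVf // scale1r.
have [coord coordP] := choice decomp.
have coord_linear : linear (coord : V -> F^o).
  move=> a u v; apply: (uniq _ _ _ (coordP _)).
  have -> : a *: u + v - (a *: (coord u : F^o) + coord v) *: x =
      a *: (u - coord u *: x) + (v - coord v *: x).
    by rewrite scalerBr scalerDl scalerA opprD addrACA.
  exact: sU.
exists (Defs.Hom (introT (asboolP _) coord_linear)) => /=.
rewrite (uniq _ 1 _ (coordP x)) ?oner_neq0 //.
by rewrite scale1r subrr.
Qed.

End DualSeparation.

(** * The action of A_D on singular vectors *)

Section Endomorphisms.
Variables (F : fieldType) (V : lmodType F).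
Implicit Types (f g : endo V) (v : V).

Lemma endoM f g v : (f * g) v = f (g v). Proof. by []. Qed.
Lemma endoD f g v : (f + g) v = f v + g v. Proof. by []. Qed.
Lemma endoZ c f v : (c *: f) v = c *: f v. Proof. by []. Qed.

Lemma endo_sum I (r : seq I) (P : pred I) (f : I -> endo V) v :
  (\sum_(i <- r | P i) f i) v = \sum_(i <- r | P i) f i v.
Proof. by elim/big_rec2: _ => [|i u w _ <-]. Qed.

Lemma endo_scalerAl c f g : (c *: f) * g = c *: (f * g).
Proof. exact: homP. Qed.

Lemma endo_scalerAr c f g : f * (c *: g) = c *: (f * g).
Proof. by apply: homP => v; apply: (linearZ_LR (f : Defs.hom V V)). Qed.

Section CommutingFamily.
Variables (J : Type) (X : J -> endo V).
Hypothesis X_comm : forall i j, X i * X j = X j * X i.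

Lemma unital_subalg_gen : unital_subalg (fun T => T \in gen_subalg_pred X).
Proof.
split=> [|c f g fX gX|f g fX gX]; first exact: rpred1.
- by rewrite rpredD // rpredZ.
- exact: rpredM.
Qed.

Lemma unital_commutant f : unital_subalg (fun g => f * g = g * f).
Proof.
split=> [|c g h fg fh|g h fg fh]; first by rewrite mulr1 mul1r.
- by rewrite mulrDr mulrDl endo_scalerAl endo_scalerAr fg fh.
- by rewrite mulrA fg -mulrA fh mulrA.
Qed.

(** Commutants are unital subalgebras: commutation spreads from the generators first to one
    argument, then to the other. *)
Lemma gen_subalg_comm f g :
  f \in gen_subalg_pred X -> g \in gen_subalg_pred X -> f * g = g * f.
Proof.
move=> fX /asboolP/(_ (fun g => f * g = g * f)); apply; first exact: unital_commutant.
move=> j; apply/esym; move/asboolP/(_ (fun f => X j * f = f * X j)): fX; apply=> //.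
exact: unital_commutant.
Qed.

End CommutingFamily.

Section PolynomialEvaluation.
Variables (k : nat) (Y : 'I_k -> endo V).
Hypothesis Y_comm : forall i j, Y i * Y j = Y j * Y i.

Definition endo_monomial (q : 'X_{1..k}) : endo V := \prod_i Y i ^+ q i.
(** Evaluation at the Y_i, multiplicative because they commute. *)
Definition endo_eval (p : {mpoly F[k]}) : endo V :=
  \sum_(q <- msupp p) p@_q *: endo_monomial q.

Lemma endo_evalE w p : (msize p <= w)%N ->
  endo_eval p = \sum_(q : 'X_{1..k < w}) p@_q *: endo_monomial q.
Proof.
move=> pw; rewrite /endo_eval; pose I : subFinType _ := 'X_{1..k < w}.
rewrite (big_mksub I) ?msupp_uniq //=; last first.
  by move=> q /msize_mdeg_lt /leq_trans; apply.
by rewrite big_rmcond //= => q /memN_msupp_eq0 ->; rewrite scale0r.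
Qed.

Fact endo_eval_linear : linear endo_eval.
Proof.
move=> c p r; pose w := maxn (msize (c *: p + r)) (maxn (msize p) (msize r)).
rewrite !(@endo_evalE w) ?leq_max ?leqnn ?orbT // scaler_sumr -big_split.
by apply: eq_bigr => q _ /=; rewrite mcoeffD mcoeffZ scalerDl scalerA.
Qed.
HB.instance Definition _ :=
  GRing.isLinear.Build F {mpoly F[k]} (endo V) *:%R endo_eval endo_eval_linear.

Lemma endo_evalX q : endo_eval 'X_[q] = endo_monomial q.
Proof. by rewrite /endo_eval msuppX big_seq1 mcoeffX eqxx scale1r. Qed.

Lemma endo_monomialD q r :
  endo_monomial (q + r) = endo_monomial q * endo_monomial r.
Proof.
rewrite /endo_monomial -prodrM_comm => [|i j _ _].
  by apply: eq_bigr => i _; rewrite mnmDE exprD.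
by apply/commrX/commr_sym/commrX; exact: Y_comm.
Qed.

Lemma endo_eval1 : endo_eval 1 = 1.
Proof.
rewrite -mpolyX0 endo_evalX /endo_monomial big1 // => i _.
by rewrite mnm0E expr0.
Qed.

Lemma endo_evalM p r : endo_eval (p * r) = endo_eval p * endo_eval r.
Proof.
rewrite {1}(mpolyE p) mulr_suml (raddf_sum endo_eval) {2}/endo_eval mulr_suml.
apply: eq_bigr => q _ /=; rewrite -scalerAl linearZ /= endo_scalerAl; congr (_ *: _).
rewrite {1}(mpolyE r) mulr_sumr (raddf_sum endo_eval) {2}/endo_eval mulr_sumr.
apply: eq_bigr => q' _ /=; rewrite -scalerAr linearZ /= endo_scalerAr.
by rewrite -mpolyXD endo_evalX endo_monomialD.
Qed.

Lemma endo_evalU i : endo_eval 'X_i = Y i.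
Proof.
rewrite endo_evalX /endo_monomial (@big_only1 _ _ _ _ i) // => [|j /negPf ji _].
  by rewrite mnm1E eqxx expr1.
by rewrite mnm1E eq_sym ji expr0.
Qed.

End PolynomialEvaluation.

End Endomorphisms.

(** * The operators b_i on singular vectors *)

Section SingularVectors.
Variables (F : numClosedFieldType) (N l : nat) (z m : 'I_N.+1 -> F).
Hypothesis z_inj : injective z.
Hypothesis sep : separating l m.
Local Notation n := N.+1.
Local Notation V := (sing l m).
Local Notation H := (Ham l z m).
Local Notation alpha i := ((p_a F n l)`_i).
Implicit Types (s : 'I_n) (v : V).

Let two_neq0 : 2%:R != 0 :> F. Proof. by rewrite pnatr_eq0. Qed.
Let char0 k : k.+1%:R != 0 :> F. Proof. by rewrite pnatr_eq0. Qed.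

Lemma sing_homog v : sing_val v \is l.-homog.
Proof. by have /andP[_ /eqP Ev] := valP v; apply/(euler_homog m). Qed.

Lemma sing_val_sum I (r : seq I) (P : pred I) (f : I -> V) :
  sing_val (\sum_(i <- r | P i) f i) = \sum_(i <- r | P i) sing_val (f i).
Proof. by elim/big_rec2: _ => [|i u w _ <-]. Qed.

Lemma Ham_comm s r : H s * H r = H r * H s.
Proof.
by apply: homP => v; apply/val_inj; exact: (@Htilde_comm F N z m z_inj l (sing_val v) s r (sing_homog v)).
Qed.

Lemma sum_Ham : \sum_s H s = 0.
Proof.
apply: homP => v; apply/val_inj; rewrite endo_sum [LHS]sing_val_sum.
exact: (sum_Htilde z m two_neq0).
Qed.

Lemma sum_z_Ham :
  \sum_s z s *: H s = (l%:R * (\sum_s m s + 1 - l%:R)) *: (1 : endo V).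
Proof.
apply: homP => v; apply/val_inj; rewrite endo_sum [LHS]sing_val_sum.
have := sum_z_Htilde two_neq0 z_inj ((euler_homog m l (sing_val v)).2 (sing_homog v)).
by have /andP[/eqP-> _] := valP v; rewrite linear0 subr0.
Qed.

Local Notation T i j := (entry z m (1 : endo V) H i j).
Local Notation top i := (top_entry m l i).

Definition sep_coef q v : F := (separate z (sing_val v))@_q.

Lemma sep_coefD q u v : sep_coef q (u + v) = sep_coef q u + sep_coef q v.
Proof.
by rewrite /sep_coef -[sing_val _]/(sing_val u + sing_val v) (raddfD (separate z)) mcoeffD.
Qed.

Lemma sep_coefZ q c v : sep_coef q (c *: v) = c * sep_coef q v.
Proof. by rewrite /sep_coef -[sing_val _]/(c *: sing_val v) /separate comp_mpolyZ mcoeffZ. Qed.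

Lemma sep_coef_sum q I (r : seq I) (P : pred I) (f : I -> V) :
  sep_coef q (\sum_(i <- r | P i) f i) = \sum_(i <- r | P i) sep_coef q (f i).
Proof.
rewrite /sep_coef sing_val_sum (raddf_sum (separate z)).
exact: (raddf_sum (mcoeff q)).
Qed.

Lemma sep_coef_relation q k j v :
  \sum_(i < l.+1) sep_coef (mnm_set q k i) (T i j v) = 0.
Proof.
rewrite -[RHS](separated_relation m z_inj k q j (sing_homog v)).
apply: eq_bigr => i _; rewrite /entry endoD sep_coefD endoZ sep_coefZ.
congr (_ + _); rewrite endo_sum sep_coef_sum; apply: eq_bigr => s _.
by rewrite endoZ sep_coefZ.
Qed.

(* b i stands for the coefficient of x^i in p(x, a): the recursion is D_h p = 0 at
   the degree i + N - 1, where b i occurs with the scalar coefficient top i. *)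
Lemma coef_op_exists : exists b : nat -> endo V,
  [/\ b l = 1, forall i, (l < i)%N -> b i = 0
    & forall i, (i < l)%N ->
      top i *: b i = - \sum_(i' < l.+1 | (i < i')%N) b i' * T i' (i + N).-1].
Proof.
(* Induction downwards from l: the step changes b only at l - k - 1, and the recursion at larger
   indices does not see this value. *)
suff step k : (k <= l)%N -> exists b : nat -> endo V,
    [/\ b l = 1, forall i, (l < i)%N -> b i = 0
      & forall i, (l - k <= i < l)%N ->
        top i *: b i = - \sum_(i' < l.+1 | (i < i')%N) b i' * T i' (i + N).-1].
  have [b [bl bhigh brec]] := step l (leqnn l).
  by exists b; split=> // i il; apply: brec; lia.
elim: k => [|k IH] kl.
  exists (fun i => if i == l then 1 else 0); split=> [|i li|i]; last by lia.
    by rewrite eqxx.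
  by case: eqVneq => // e; lia.
have [b [bl bhigh brec]] := IH (ltnW kl).
pose rhs i := - \sum_(i' < l.+1 | (i < i')%N) b i' * T i' (i + N).-1.
exists (fun i => if i == (l - k.+1)%N then (top i)^-1 *: rhs i else b i).
split=> [|i li|i ik].
- by case: eqVneq => //; lia.
- by case: eqVneq => [e|_]; [lia | exact: bhigh].
- have -> : \sum_(i' < l.+1 | (i < i')%N)
      (if i' == (l - k.+1)%N :> nat then (top i')^-1 *: rhs i' else b i') *
        T i' (i + N).-1 = \sum_(i' < l.+1 | (i < i')%N) b i' * T i' (i + N).-1.
    by apply: eq_bigr => i' ii'; case: eqVneq => // e; lia.
  case: eqVneq => [_|ne]; last by apply: brec; lia.
  by rewrite scalerA mulfV ?scale1r //; apply: top_entry_neq0 => //; lia.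
Qed.

Section Recursion.
Variable b : nat -> endo V.
Hypothesis b_top : b l = 1.
Hypothesis b_high : forall i, (l < i)%N -> b i = 0.
Hypothesis b_rec : forall i, (i < l)%N ->
  top i *: b i = - \sum_(i' < l.+1 | (i < i')%N) b i' * T i' (i + N).-1.

Let Gen := fun f : endo V => f \in gen_subalg_pred H.

Lemma gen_entry i j : Gen (T i j).
Proof.
have [G1 GD _] := unital_subalg_gen H.
rewrite /Gen /entry rpredD //; first by rewrite rpredZ.
by apply: rpred_sum => s _; rewrite rpredZ // gen_subalg_mem.
Qed.

Lemma gen_coef_op i : Gen (b i).
Proof.
have [il|li] := leqP i l; last by rewrite b_high // /Gen rpred0.
rewrite (_ : i = l - (l - i))%N; last by lia.
have : (l - i <= l)%N by lia.
elim/ltn_ind: (l - i)%N => k IH kl {il}.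
have [->|k0] := posnP k; first by rewrite subn0 b_top; case: (unital_subalg_gen H).
have lk : (l - k < l)%N by lia.
have c0 : top (l - k) != 0 by exact: top_entry_neq0.
rewrite -[b _]scale1r -(mulVf c0) -scalerA b_rec // /Gen rpredZ // rpredN.
apply: rpred_sum => i' ii'; apply: rpredM; last exact: gen_entry.
rewrite (_ : i' = l - (l - i') :> nat)%N; last by have := ltn_ord i'; lia.
by apply: IH; have := ltn_ord i'; lia.
Qed.

Let gen_comm f g : Gen f -> Gen g -> f * g = g * f.
Proof. exact: (gen_subalg_comm Ham_comm). Qed.

Lemma sum_vanish_below (M : nmodType) (f : nat -> M) i : (i <= l)%N ->
  (forall i', (i' < i)%N -> f i' = 0) ->
  \sum_(i' < l.+1) f i' = f i + \sum_(i' < l.+1 | (i < i')%N) f i'.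
Proof.
move=> il f0; have il' : (i < l.+1)%N by [].
rewrite (bigD1 (Ordinal il')) //=; congr (_ + _).
rewrite big_mkcond [RHS]big_mkcond; apply: eq_bigr => i' _ /=.
rewrite -val_eqE /=; case: (ltngtP i i') => // lt.
by rewrite f0.
Qed.

(** Downward induction on i: [sep_coef_relation] at degree i + N - 1, solved for the coefficient at
    u_k^i, is the recursion that defines [b i]. *)
Lemma sep_coef_shift q k i v : (i <= l)%N ->
  sep_coef (mnm_set q k i) v = sep_coef (mnm_set q k l) (b i v).
Proof.
move=> il; rewrite (_ : i = l - (l - i))%N; last by lia.
have : (l - i <= l)%N by lia.
elim/ltn_ind: (l - i)%N v => d IH v dl {il}.
have [->|d0] := posnP d; first by rewrite subn0 b_top.
have N0 : (0 < N)%N by exact: leq_ltn_trans (ltn_ord k).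
set i0 := (l - d)%N; have il : (i0 < l)%N by lia.
have c0 : top i0 != 0 by exact: top_entry_neq0.
have ij : ((i0 + N).-1.+1 = i0 + N)%N by lia.
have := sep_coef_relation q k (i0 + N).-1 v.
rewrite (sum_vanish_below (f := fun i => sep_coef (mnm_set q k i) (T i (i0 + N).-1 v)) (ltnW il)).
  rewrite (entry_top sum_Ham sum_z_Ham ij) endoZ sep_coefZ => /eqP.
  rewrite addr_eq0 => /eqP e; apply: (mulfI c0); rewrite e.
  rewrite -sep_coefZ -endoZ b_rec // -[in RHS]sumrN endo_sum sep_coef_sum -sumrN.
  apply: eq_bigr => i' ii'; rewrite -mulNr.
  have -> : - b i' * T i' (i0 + N).-1 = -1 *: (b i' * T i' (i0 + N).-1).
    by rewrite scaleN1r mulNr.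
  rewrite endoZ sep_coefZ mulN1r endoM; congr (- _).
  have i'l : (i' <= l)%N by rewrite -ltnS.
  by have := IH (l - i')%N; rewrite subKn //; apply; [move: ii' | ]; lia.
move=> i' ii'; rewrite (entry_high _ _ _ sum_Ham); last by lia.
by rewrite /sep_coef (raddf0 (separate z)) mcoeff0.
Qed.

Lemma sep_coef_high (q : 'X_{1..N}) (k : 'I_N) v : (l < q k)%N -> sep_coef q v = 0.
Proof. by move=> lq; apply: (var_degree_separate z (k := k) (sing_homog v)). Qed.

Lemma sing_eq0 v : (forall q, sep_coef q v = 0) -> v = 0.
Proof.
move=> v0; apply/val_inj; apply: (separate_inj z_inj (sing_homog v)).
by apply/mpolyP => q; rewrite mcoeff0; exact: v0.
Qed.

(** Let Q be the sum. By [sep_coef_shift] and [sep_coef_relation], Q v has no coefficient at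
    exponent l in u_k. Every other coefficient of Q v reduces to such a one, since Q commutes with
    the b_i. So Q v = 0 by injectivity of [separate]. *)
Lemma coef_op_relation j : \sum_(i < l.+1) b i * T i j = 0.
Proof.
set Q := \sum_(i < l.+1) _.
(* For N = 0 there is no coordinate u_k to use, and the relation is the recursion itself at i = j +
   1, or [top_entry_self] if j + 1 = l. *)
have [N0|N0] := posnP N.
  have [jl|lj] := ltnP j l; last first.
    by apply: big1 => i _; rewrite (entry_high _ _ _ sum_Ham) ?mulr0 //; have := ltn_ord i; lia.
  have ij : (j.+1 = j.+1 + N)%N by lia.
  rewrite /Q (sum_vanish_below (f := fun i => b i * T i j) jl) => [|i' ii']; last first.
    by rewrite (entry_high _ _ _ sum_Ham) ?mulr0 //; lia.
  rewrite (entry_top sum_Ham sum_z_Ham ij) endo_scalerAr mulr1.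
  move: jl; rewrite leq_eqVlt => /predU1P[jl|jl].
    rewrite jl top_entry_self scale0r add0r big1 // => i; have := ltn_ord i; lia.
  by rewrite b_rec //= (_ : (j + N)%N = j) ?addNr //; lia.
have QG : Gen Q.
  by apply: rpred_sum => i _; apply: rpredM; [exact: gen_coef_op | exact: gen_entry].
have Q0 q k v : sep_coef (mnm_set q k l) (Q v) = 0.
  rewrite -[RHS](sep_coef_relation q k j v) endo_sum sep_coef_sum.
  apply: eq_bigr => i _; rewrite endoM -sep_coef_shift //.
  by rewrite -ltnS.
apply: homP => v; apply: sing_eq0 => q; pose k := Ordinal N0.
have [qk|lq] := leqP (q k) l; last exact: sep_coef_high lq.
rewrite -(mnm_set_id q k) sep_coef_shift // -endoM (gen_comm (gen_coef_op _) QG).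
exact: Q0.
Qed.

(** [sep_coef_shift] raises the exponents to l, one coordinate after another. *)
Lemma sep_coef_prod (q : 'X_{1..N}) v : (forall k, (q k <= l)%N) ->
  sep_coef q v = sep_coef [multinom l | k < N] ((\prod_k b (q k)) v).
Proof.
move=> ql; pose qr (r : seq 'I_N) := [multinom if k \in r then l else q k | k < N].
suff IH r : uniq r -> sep_coef q v = sep_coef (qr r) ((\prod_(k <- r) b (q k)) v).
  rewrite (IH (index_enum 'I_N)) ?index_enum_uniq //; congr sep_coef.
  by apply/mnmP => k; rewrite !mnmE mem_index_enum.
elim: r => [|k r IH] /=.
  by rewrite big_nil (_ : qr [::] = q) //; apply/mnmP => k; rewrite mnmE.
move=> /andP[kr ur]; rewrite big_cons endoM {}IH //.
have -> : qr (k :: r) = mnm_set (qr r) k l.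
  by apply/mnmP => k'; rewrite mnm_setE !mnmE inE; case: eqVneq.
rewrite -sep_coef_shift //; congr sep_coef.
apply/mnmP => k'; rewrite mnm_setE !mnmE; case: eqVneq => // ->.
by rewrite (negPf kr).
Qed.

End Recursion.

End SingularVectors.

(** * The representation of [A_D] on Sing and the preimages under tau *)

Section Representation.
Variables (F : numClosedFieldType) (N l : nat) (z m : 'I_N.+1 -> F).
Hypothesis z_inj : injective z.
Hypothesis sep : separating l m.
Local Notation n := N.+1.
Local Notation V := (sing l m).
Local Notation H := (Ham l z m).
Local Notation RD := {mpoly F[l + n]}.
Local Notation AD := (A_D l z m).
Local Notation alpha i := ((p_a F n l)`_i).
Local Notation pi := (@pi_D F n l z m).

Variable b : nat -> endo V.
Hypothesis b_top : b l = 1.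
Hypothesis b_high : forall i, (l < i)%N -> b i = 0.
Hypothesis b_rec : forall i, (i < l)%N -> top_entry m l i *: b i =
  - \sum_(i' < l.+1 | (i < i')%N) b i' * entry z m (1 : endo V) H i' (i + N).-1.

(** The variable of index j among the a's is the coefficient of x^(l - j - 1) in p, hence the index
    of b. *)
Definition var_op (i : 'I_(l + n)) : endo V :=
  match split i with inl j => b (l - j.+1) | inr s => H s end.

Lemma var_op_gen i : var_op i \in gen_subalg_pred H.
Proof.
rewrite /var_op; case: (split i) => [j|s]; last exact: gen_subalg_mem.
exact: gen_coef_op.
Qed.

Lemma var_op_comm i j : var_op i * var_op j = var_op j * var_op i.
Proof.
by apply: (gen_subalg_comm (@Ham_comm F N l z m z_inj)); exact: var_op_gen.
Qed.

Local Notation rho := (endo_eval var_op).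

Lemma rho_hvar s : rho (hvar F l s) = H s.
Proof. by rewrite endo_evalU /var_op (unsplitK (inr s)). Qed.

Lemma rho_alpha i : rho (alpha i) = b i.
Proof.
have [il|li|->] := ltngtP i l; last first.
- by rewrite p_a_coef_top endo_eval1 b_top.
- by rewrite p_a_coef_high // raddf0 b_high.
have jl : (l - i.+1 < l)%N by lia.
have {1}-> : i = (l - (Ordinal jl).+1)%N by rewrite /=; lia.
rewrite p_a_coef_avar endo_evalU /var_op (unsplitK (inl (Ordinal jl))) /=.
by congr b; lia.
Qed.

Lemma rho_entry i j : rho (entry z m (1 : RD) (hvar F l) i j) = entry z m (1 : endo V) H i j.
Proof.
rewrite /entry [LHS](raddfD rho) (raddf_sum rho) /=; congr (_ + _).
  by rewrite [LHS]linearZ /= endo_eval1.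
by apply: eq_bigr => s _; rewrite [LHS]linearZ /= rho_hvar.
Qed.

Lemma rho_q_D j : rho (@q_D F n l z m j) = 0.
Proof.
case: j => -[|[|i]] ij; rewrite /q_D /=.
- rewrite (raddf_sum rho) -[RHS](sum_Ham l z m).
  by apply: eq_bigr => s _; exact: rho_hvar.
- rewrite (raddfB rho) (raddf_sum rho) /= -alg_mpolyC [X in _ - X]linearZ /= endo_eval1.
  apply/eqP; rewrite subr_eq0 -(@sum_z_Ham F N l z m z_inj); apply/eqP.
  by apply: eq_bigr => s _; rewrite linearZ /= rho_hvar.
- rewrite D_h_coef (raddf_sum rho) /=.
  rewrite -[RHS](coef_op_relation z_inj sep b_top b_high b_rec (l + n - 2 - i.+1)).
  apply: eq_bigr => i' _; rewrite (endo_evalM var_op_comm) rho_entry.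
  by rewrite rho_alpha.
Qed.

Definition rep (x : AD) : endo V := rho (repr x).

Lemma rep_pi f : rep (pi f) = rho f.
Proof.
apply/eqP; rewrite -subr_eq0 -(raddfB rho); apply/eqP.
have /asboolP[c ->] := quot_repr_pi (@q_D F n l z m) f.
rewrite (raddf_sum rho) big1 // => j _ /=.
by rewrite (endo_evalM var_op_comm) rho_q_D mulr0.
Qed.

Fact rep_zmod : zmod_morphism rep.
Proof.
move=> x y; rewrite -(quot_reprK x) -(quot_reprK y) -(raddfB (quot_pi _)).
by rewrite !rep_pi (raddfB rho).
Qed.

Fact rep_monoid : monoid_morphism rep.
Proof.
split=> [|x y]; first by rewrite -[1]/(pi 1) rep_pi endo_eval1.
rewrite -(quot_reprK x) -(quot_reprK y) -[_ * _](pi_D_mul _ _).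
by rewrite !rep_pi (endo_evalM var_op_comm).
Qed.

Fact rep_scale : scalable rep.
Proof.
move=> c x; rewrite -(quot_reprK x) -[_ *: _](pi_D_scale _ _) !rep_pi.
exact: linearZ.
Qed.

Lemma rep_h s : rep (h_D l z m s) = H s.
Proof. by rewrite rep_pi rho_hvar. Qed.

Lemma rep_gen x : rep x \in gen_subalg_pred H.
Proof.
have [G1 GD GM] := unital_subalg_gen H.
have rep0 : rep 0 = 0 by have := rep_zmod 0 0; rewrite !subrr.
have repN u : rep (- u) = - rep u by have := rep_zmod 0 u; rewrite rep0 !sub0r.
have repD u v : rep (u + v) = rep u + rep v.
  by rewrite -{1}[v]opprK rep_zmod repN opprK.
have char0 k : k.+1%:R != 0 :> F by rewrite pnatr_eq0.
apply: (@A_D_generated F N l z m char0 sep (fun x => rep x \in gen_subalg_pred H)) => //.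
- by rewrite rep_monoid.1.
- by move=> c f g fH gH; rewrite repD rep_scale; exact: GD.
- by move=> f g fH gH; rewrite rep_monoid.2; exact: GM.
- by move=> s; rewrite rep_h gen_subalg_mem.
Qed.

Definition psi_rep (x : AD) : A_M l z m := GenSubalg (rep_gen x).

Fact psi_rep_zmod : zmod_morphism psi_rep.
Proof. by move=> x y; apply/val_inj; exact: rep_zmod. Qed.
Fact psi_rep_monoid : monoid_morphism psi_rep.
Proof.
by split=> [|x y]; apply/val_inj; [exact: rep_monoid.1 | exact: rep_monoid.2].
Qed.
HB.instance Definition _ := GRing.isZmodMorphism.Build AD (A_M l z m) psi_rep psi_rep_zmod.
HB.instance Definition _ := GRing.isMonoidMorphism.Build AD (A_M l z m) psi_rep psi_rep_monoid.

Lemma psi_rep_is_psi_DM : is_psi_DM (psi_rep : {rmorphism AD -> A_M l z m}).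
Proof.
split=> [c x|s|T]; first by apply/val_inj; exact: rep_scale.
  by apply/val_inj; exact: rep_h.
case: T => T TH; suff [x Tx] : exists x, rep x = T.
  by exists x; apply/val_inj.
move/asboolP: TH => /(_ (fun T => exists x, rep x = T)); apply.
  split=> [|c _ _ [x <-] [y <-]|_ _ [x <-] [y <-]].
  - by exists 1; exact: rep_monoid.1.
  - exists (c *: x - - y); rewrite rep_zmod rep_scale; congr (_ + _).
    have := rep_zmod 0 y; have := rep_zmod 0 0; rewrite !subrr => ->.
    by rewrite !sub0r => ->; rewrite opprK.
  - by exists (x * y); exact: rep_monoid.2.
by move=> s; exists (h_D l z m s); exact: rep_h.
Qed.

Definition top_coef (v : V) : F := sep_coef z [multinom l | k < N] v.

Fact sing_functional_linear v :
  linear ((fun x => (-1) ^+ (l * N) * top_coef (rep x v)) : AD -> F^o).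
Proof.
move=> c x y.
have -> : rep (c *: x + y) = c *: rep x + rep y.
  rewrite -(quot_reprK x) -(quot_reprK y) -(pi_D_scale _ _).
  by rewrite -[_ + _](raddfD (quot_pi _)) !rep_pi linearD /= linearZ.
rewrite endoD endoZ /top_coef sep_coefD sep_coefZ mulrDr mulrCA.
by [].
Qed.

Definition sing_functional v : dual AD := Defs.Hom (introT (asboolP _) (sing_functional_linear v)).

(** By [separate_tau] the coefficient at u^q is the top coefficient of (prod_k b_(q_k)) v, which is
    that of v by [sep_coef_prod]; the two signs cancel. If some exponent exceeds l, both sides are
    0. *)
Lemma tau_sing_functional v : tau_fun (sing_functional v) = sing_val v.
Proof.
apply/eqP; rewrite -subr_eq0; apply/eqP.
apply: (separate_inj z_inj (l := l)).
  by rewrite rpredB // ?tau_homog ?sing_homog.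
rewrite (raddfB (separate z)) /=; apply/mpolyP => q; rewrite mcoeffB mcoeff0.
apply/eqP; rewrite subr_eq0; apply/eqP; rewrite separate_tau //=.
rewrite mulrA -exprD addnn -mul2n exprM sqrrN expr1n expr1n mul1r rep_pi.
have [/forallP ql|/forallPn[k]] := boolP [forall k, (q k <= l)%N].
  have -> : rho (\prod_(k < N) alpha (q k)) = \prod_(k < N) b (q k).
    elim/big_rec2: _ => [|k f g _ <-]; first exact: endo_eval1.
    by rewrite (endo_evalM var_op_comm) rho_alpha.
  by rewrite /top_coef -(sep_coef_prod z_inj sep b_top b_rec).
rewrite -ltnNge => lq.
rewrite -/(sep_coef z q v) (sep_coef_high z v lq).
rewrite (bigD1 k) //= p_a_coef_high // mul0r raddf0.
by rewrite /top_coef /sep_coef (raddf0 (separate z)) mcoeff0.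
Qed.

End Representation.

(** * The isomorphisms *)

Section Isomorphism.
Variables (F : numClosedFieldType) (N l : nat) (z m : 'I_N.+1 -> F).
Hypothesis z_inj : injective z.
Hypothesis sep : separating l m.
Local Notation n := N.+1.
Local Notation V := (sing l m).
Local Notation AD := (A_D l z m).

Let char0 k : k.+1%:R != 0 :> F. Proof. by rewrite pnatr_eq0. Qed.

Definition tau (g : dual AD) : V := Sing (tau_sing z_inj g).

Fact tau_linear : linear tau.
Proof. by move=> c g h; apply/val_inj; exact: tau_fun_linear. Qed.
HB.instance Definition _ := GRing.isLinear.Build F (dual AD) V *:%R tau tau_linear.

Lemma transpose_L_DM (f f' : AD) g :
  transpose (L_D (f * f')) g = transpose (L_D f') (transpose (L_D f) g).
Proof. by apply: homP => x; rewrite /= mulrA. Qed.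

Lemma transpose_L_DD c (f f' : AD) g :
  transpose (L_D (c *: f + f')) g = c *: transpose (L_D f) g + transpose (L_D f') g.
Proof.
by apply: homP => x; rewrite /= mulrDl A_D_scalerAl dualD dualZ.
Qed.

Lemma transpose_L_D1 g : transpose (L_D (1 : AD)) g = g.
Proof. by apply: homP => x; rewrite /= mul1r. Qed.

(** The kernel is stable under the L_f^*, because [A_D] is generated by the h_s and these act
    through Htilde_s. Up to sign, h(1) is the coefficient of prod_k u_k^l in the separated form of
    tau h, as p is monic. So g in the kernel has g(x) = (L_x^* g)(1) = 0. *)
Lemma tau_inj : injective tau.
Proof.
suff ker g : tau g = 0 -> g = 0.
  move=> g h e; apply/eqP; rewrite -subr_eq0; apply/eqP/ker.
  by rewrite raddfB /= e subrr.
have stable (f : AD) : forall g, tau g = 0 -> tau (transpose (L_D f) g) = 0.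
  apply: (@A_D_generated F N l z m char0 sep
    (fun f => forall g, tau g = 0 -> tau (transpose (L_D f) g) = 0)) => {f g}.
  - by move=> g; rewrite transpose_L_D1.
  - move=> c f f' fK f'K g g0; rewrite transpose_L_DD [LHS]tau_linear.
    by rewrite fK // f'K // scaler0 addr0.
  - by move=> f f' fK f'K g g0; rewrite transpose_L_DM f'K // fK.
  - move=> s g /(congr1 val) /= g0; apply/val_inj => /=.
    by rewrite -Htilde_tau // g0 linear0.
have at1 h : tau h = 0 -> h 1 = 0.
  move=> /(congr1 val) /= h0.
  have := separate_tau z_inj h [multinom l | k < N]; rewrite h0.
  rewrite (raddf0 (separate z)) mcoeff0 => /esym/eqP; rewrite mulf_eq0.
  rewrite signr_eq0 /= => /eqP.
  rewrite (_ : \prod_(k < N) _ = 1) ?pi_D1 // big1 // => k _.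
  by rewrite mnmE p_a_coef_top.
move=> g0; apply: homP => x.
by have := at1 _ (stable x g g0); rewrite /= mulr1.
Qed.

Lemma tau_bij : bijective tau.
Proof.
have [b [b_top b_high b_rec]] := coef_op_exists z sep.
have K : cancel (sing_functional z_inj sep b_top b_high b_rec) tau.
  by move=> v; apply/val_inj; exact: tau_sing_functional.
by exists (sing_functional z_inj sep b_top b_high b_rec) => // g; apply: tau_inj.
Qed.

(** It is enough to check the h_s, where this is [Htilde_tau]. Duality reverses products, which is
    harmless as [A_D] is commutative. *)
Lemma tau_intertwines (psi : {rmorphism AD -> A_M l z m}) : is_psi_DM psi ->
  forall f g, tau (transpose (L_D f) g) = (psi f : endo V) (tau g).
Proof.
case=> psiZ psi_h _.
apply: (@A_D_generated F N l z m char0 sep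
  (fun f => forall g, tau (transpose (L_D f) g) = (psi f : endo V) (tau g))).
- by move=> g; rewrite transpose_L_D1 rmorph1.
- move=> c f f' fE f'E g; rewrite transpose_L_DD [LHS]tau_linear fE f'E.
  by rewrite rmorphD psiZ.
- move=> f f' fE f'E g; rewrite transpose_L_DM f'E fE.
  by rewrite mulrC rmorphM.
- by move=> s g; rewrite psi_h; apply/val_inj; rewrite /= Htilde_tau.
Qed.

(** If psi kills d = f - f', then tau(L_d^* g) = 0 for all g, so L_d^* g = 0 and g(d) = (L_d^* g)(1)
    = 0; functionals separate points, hence d = 0. *)
Lemma psi_DM_bij (psi : {rmorphism AD -> A_M l z m}) : is_psi_DM psi -> bijective psi.
Proof.
move=> psiP; have [_ _ psi_surj] := psiP.
have psi_inj : injective psi.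
  move=> f f' e; apply/eqP; rewrite -subr_eq0; apply: contraT => d0.
  have [g] := dual_separates d0; case/negP.
  have : tau (transpose (L_D (f - f')) g) = 0.
    by rewrite (tau_intertwines psiP) rmorphB e subrr.
  rewrite -[RHS](raddf0 tau) => /tau_inj /(congr1 (fun h : dual AD => h 1)) /=.
  by rewrite mulr1 => ->.
have [inv invK] := choice psi_surj.
by exists inv => // f; apply: psi_inj.
Qed.

Lemma Bethe_algebra_isomorphism :
  (exists psi : {rmorphism AD -> A_M l z m}, is_psi_DM psi) /\
  forall psi : {rmorphism AD -> A_M l z m}, is_psi_DM psi ->
    (exists tau : {linear dual AD -> V},
       [/\ forall g, sing_val (tau g) = tau_fun g,
           bijective tau
         & forall (f : AD) (g : dual AD),
             tau (transpose (L_D f) g) = (psi f : endo V) (tau g)]) /\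
    bijective psi.
Proof.
split.
  have [b [b_top b_high b_rec]] := coef_op_exists z sep.
  exists (psi_rep z_inj sep b_top b_high b_rec); exact: psi_rep_is_psi_DM.
move=> psi psiP; split; last exact: psi_DM_bij.
by exists tau; split=> //; [exact: tau_bij | exact: tau_intertwines].
Qed.

End Isomorphism.

Theorem corollary4p3p2 (R : realType) (n l : nat) (z m : 'I_n -> R[i])
    (n_gt0 : (0 < n)%N) (z_inj : injective z) (sep : separating l m) :
  (exists psi : {rmorphism A_D l z m -> A_M l z m}, is_psi_DM psi) /\
  forall psi : {rmorphism A_D l z m -> A_M l z m}, is_psi_DM psi ->
    (exists tau : {linear dual (A_D l z m) -> sing l m},
       [/\ forall g, sing_val (tau g) = tau_fun g,
           bijective tau
         & forall (f : A_D l z m) (g : dual (A_D l z m)),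
             tau (transpose (L_D f) g) = (psi f : endo (sing l m)) (tau g)]) /\
    bijective psi.
Proof.
by case: n n_gt0 z m z_inj sep => // N _ z m z_inj sep; exact: Bethe_algebra_isomorphism.
Qed.
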